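(* Let $d \geq 2$ be an integer. The Hartshorne-Rao module $M_C$ of the curve $C \subset \mathbb{P}^3$ defined by the ideal $J = (xz - yt,\ (y,z)^d) \subset R$ is $$M_C \cong \operatorname{coker}\left( R^{2d}(-1) \xrightarrow{\begin{bmatrix} N_d^t & M_d^t \end{bmatrix}} R^{d-1} \right).$$ Moreover, its minimal free resolution is of the form $$0 \to R^{d-1}(-d-2) \to R^{2d}(-d-1) \to R^{d+1}(-d) \oplus R^{d+1}(-2) \to R^{2d}(-1) \to R^{d-1} \to M_C \to 0.$$
   Context: $K$ is an algebraically closed field, $\mathbb{P}^3 = \mathbb{P}^3_K$, $R = K[x,y,z,t]$ its homogeneous coordinate ring. A curve is a pure one-dimensional locally Cohen-Macaulay closed subscheme of $\mathbb{P}^3$. The Hartshorne-Rao module of a curve $C$ with ideal sheaf $\mathscr{I}_C$ is the graded $R$-module $M_C = \bigoplus_{j\in\mathbb{Z}} H^1(\mathbb{P}^3,\mathscr{I}_C(j))$. For $i \geq 2$, $M_i$ and $N_i$ are the $i \times (i-1)$ matrices $$M_i = \begin{bmatrix} y & & & 0 \\ -x & y & & \\ & -x & \ddots & \\ & & \ddots & y \\ 0 & & & -x \end{bmatrix}, \qquad N_i = \begin{bmatrix} z & & & 0 \\ -t & z & & \\ & -t & \ddots & \\ & & \ddots & z \\ 0 & & & -t \end{bmatrix},$$ i.e. $(M_i)_{k,k} = y$, $(M_i)_{k+1,k} = -x$, $(N_i)_{k,k} = z$, $(N_i)_{k+1,k} = -t$ for $1 \le k \le i-1$, all other entries being zero.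 The superscript $t$ in $N_d^t$, $M_d^t$ denotes the transpose. *)

(* Defs.v *)
From HB Require Import structures.
From mathcomp Require Import all_boot all_order all_algebra.
From mathcomp Require Import boolp classical_sets.
From mathcomp Require Import mpoly.

Set Implicit Arguments.
Unset Strict Implicit.
Unset Printing Implicit Defensive.

Import Order.TTheory GRing.Theory Num.Theory.
Local Open Scope ring_scope.
Local Open Scope quotient_scope.
Local Open Scope classical_set_scope.

Local Notation "a %:F" := (tofrac a) : ring_scope.

Notation coordring K := {mpoly K[4]}.

(* Finite sums of elements of the subgroups [D j], the [j]'s being distinct. *)
Definition dsum (V : zmodType) (D : int -> set V) : set V := fun u =>
  exists (s : seq int) (c : int -> V),
    [/\ uniq s, forall j, D j (c j) & u = \sum_(j <- s) c j].

Definition dfree (V : zmodType) (D : int -> set V) : Prop :=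
  forall (s : seq int) (c : int -> V), uniq s -> (forall j, D j (c j)) ->
    \sum_(j <- s) c j = 0 -> forall j, j \in s -> c j = 0.

Record gfamily (K : fieldType) (V : lmodType (coordring K))
    (D : int -> set V) : Prop := GFamily {
  gfam0 : forall j, D j 0;
  gfamB : forall j u v, D j u -> D j v -> D j (u - v);
  gfamZ : forall (k : nat) j (p : coordring K) u,
    p \is k.-homog -> D j u -> D (j + k%:Z) (p *: u);
  gfam_free : dfree D }.

Record gmod (K : fieldType) := GMod {
  gsort :> lmodType (coordring K);
  gpiece : int -> set gsort;
  gpiece_fam : gfamily gpiece;
  gpiece_span : forall u : gsort, dsum gpiece u }.

Record ghom (K : fieldType) (M N : gmod K) := GHom {
  ghom_fun :> {linear M -> N};
  ghom_piece : forall j u, gpiece j u -> gpiece j (ghom_fun u) }.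

Definition giso (K : fieldType) (M N : gmod K) : Prop :=
  exists f : {linear M -> N},
    bijective f /\ forall j u, gpiece j u <-> gpiece j (f u).

Section DSum.
Variables (V : zmodType) (D : int -> set V).
Hypothesis D0 : forall j, D j 0.
Hypothesis DB : forall j u v, D j u -> D j v -> D j (u - v).

Lemma fam_add j u v : D j u -> D j v -> D j (u + v).
Proof.
by move=> hu hv; rewrite -[v]opprK; apply: DB => //; rewrite -sub0r; apply: DB.
Qed.

Lemma big_ext (s r : seq int) (c : int -> V) : uniq s -> uniq r ->
  {subset s <= r} ->
  \sum_(j <- r) (if j \in s then c j else 0) = \sum_(j <- s) c j.
Proof.
move=> us ur sr; rewrite -big_mkcond -big_filter; apply: perm_big.
apply: uniq_perm => //; first exact: filter_uniq.
by move=> j; rewrite mem_filter; apply: andb_idr => /sr.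
Qed.

Lemma dsum_ext (s t : seq int) (c e : int -> V) : uniq s -> uniq t ->
  (forall j, D j (c j)) -> (forall j, D j (e j)) ->
  exists r c' e', [/\ uniq r, {subset s <= r} /\ {subset t <= r},
    (forall j, D j (c' j)) /\ (forall j, D j (e' j)),
    (forall j, j \in s -> c' j = c j) /\ (forall j, j \in t -> e' j = e j) &
    \sum_(j <- s) c j = \sum_(j <- r) c' j /\
    \sum_(j <- t) e j = \sum_(j <- r) e' j].
Proof.
move=> us ut hc he; pose r := undup (s ++ t).
exists r, (fun j => if j \in s then c j else 0),
  (fun j => if j \in t then e j else 0).
have sr : {subset s <= r} by move=> j js; rewrite mem_undup mem_cat js.
have tr : {subset t <= r} by move=> j jt; rewrite mem_undup mem_cat jt orbT.
split; rewrite ?undup_uniq //.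
- by split=> j; case: ifP.
- by split=> j ->.
- by rewrite !big_ext ?undup_uniq.
Qed.

Lemma dsum0 : dsum D 0.
Proof. by exists [::], (fun=> 0); split; rewrite ?big_nil. Qed.

Lemma dsumB u v : dsum D u -> dsum D v -> dsum D (u - v).
Proof.
case=> s [c [us hc ->]] [t [e [ut he ->]]].
have [r [c' [e' [ur _ [hc' he'] _ [-> ->]]]]] := dsum_ext us ut hc he.
exists r, (fun j => c' j - e' j); split=> //; first by move=> j; apply: DB.
by rewrite sumrB.
Qed.

Lemma dsumD u v : dsum D u -> dsum D v -> dsum D (u + v).
Proof.
move=> hu hv; rewrite -[v]opprK; apply: dsumB => //.
by rewrite -sub0r; apply: dsumB => //; apply: dsum0.
Qed.

Lemma dsum1 j u : D j u -> dsum D u.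
Proof.
move=> h; exists [:: j], (fun k => if k == j then u else 0).
by split=> [//|k|]; [case: eqP => [->|] | rewrite big_seq1 eqxx].
Qed.

Lemma dsum_sum (I : Type) (r : seq I) (F : I -> V) :
  (forall i, dsum D (F i)) -> dsum D (\sum_(i <- r) F i).
Proof.
by move=> h; apply: (big_ind (dsum D)) => //; [apply: dsum0 | apply: dsumD].
Qed.

Lemma dfree_eq (s t : seq int) (c e : int -> V) : dfree D -> uniq s -> uniq t ->
  (forall j, D j (c j)) -> (forall j, D j (e j)) ->
  \sum_(j <- s) c j = \sum_(j <- t) e j ->
  forall j, j \in s -> c j = if j \in t then e j else 0.
Proof.
move=> fD us ut hc he E j js; pose r := undup (s ++ t).
have sr : {subset s <= r} by move=> i js'; rewrite mem_undup mem_cat js'.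
have tr : {subset t <= r} by move=> i jt; rewrite mem_undup mem_cat jt orbT.
have := fD r (fun i => (if i \in s then c i else 0) -
                       (if i \in t then e i else 0)) (undup_uniq _).
move=> /(_ _ _ j (sr _ js)); rewrite js => H; apply/eqP; rewrite -subr_eq0.
apply/eqP/H => [i|]; first by apply: DB; case: ifP.
by rewrite sumrB !big_ext ?undup_uniq // E subrr.
Qed.

End DSum.

Section DSumMod.
Variables (K : fieldType) (V : lmodType (coordring K)) (D : int -> set V).
Hypothesis hD : gfamily D.

Lemma dsumZ (p : coordring K) u : dsum D u -> dsum D (p *: u).
Proof.
case=> s [c [us hc ->]]; rewrite scaler_sumr; apply: dsum_sum.
- exact: gfam0 hD.
- exact: gfamB hD.
move=> j; rewrite (pihomog_partitionE (mf := mdeg) (leqnn (mmeasure mdeg p))).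
rewrite scaler_suml; apply: dsum_sum.
- exact: gfam0 hD.
- exact: gfamB hD.
move=> i; apply: (@dsum1 _ _ (gfam0 hD) (j + i%:Z)).
by apply: gfamZ => //; apply: pihomogP.
Qed.

End DSumMod.

Section GSub.
Variables (K : fieldType) (V : lmodType (coordring K)) (D : int -> set V).
Variable hD : gfamily D.

Definition gsub_pred of gfamily D : {pred V} := fun u => `[< dsum D u >].

Lemma gsub_submod : submod_closed (gsub_pred hD).
Proof.
split; first by apply/asboolP; apply: dsum0; apply: gfam0 hD.
move=> a u v /asboolP hu /asboolP hv; apply/asboolP.
apply: dsumD; [exact: gfam0 hD | exact: gfamB hD | exact: dsumZ | by []].
Qed.

HB.instance Definition _ :=
  GRing.isSubmodClosed.Build _ V (gsub_pred hD) gsub_submod.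

Record gsub_type := GSub { gsub_val : V; _ : gsub_val \in gsub_pred hD }.
HB.instance Definition _ := [isSub for gsub_val].
HB.instance Definition _ := [Choice of gsub_type by <:].
HB.instance Definition _ := [SubChoice_isSubLmodule of gsub_type by <:].

Definition gsub_piece (j : int) : set gsub_type := fun u => D j (val u).

Lemma gsub_fam : gfamily gsub_piece.
Proof.
split=> [j|j u v|k j p u hp|s c us hc].
- by rewrite /gsub_piece raddf0; apply: gfam0 hD _.
- by rewrite /gsub_piece raddfB; apply: gfamB hD _ _ _.
- by rewrite /gsub_piece linearZ; apply: gfamZ hD _ _ _ _ hp.
move=> /(congr1 val); rewrite raddf_sum raddf0 => E j js; apply: val_inj.
by rewrite raddf0; apply: (gfam_free hD us hc E).
Qed.

Lemma gsub_mem j u : D j u -> u \in gsub_pred hD.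
Proof. by move=> h; apply/asboolP; apply: dsum1 h; apply: gfam0 hD. Qed.

Lemma gsub_span u : dsum gsub_piece u.
Proof.
case: u => u /[dup] /asboolP [s [c [us hc E]]] hu.
exists s, (fun j => GSub (gsub_mem (hc j))); split=> //.
by apply: val_inj; rewrite raddf_sum.
Qed.

Definition gsub : gmod K := GMod gsub_fam gsub_span.

End GSub.

Section Coker.
Variables (K : fieldType) (M N : gmod K) (f : ghom M N).

Definition im_pred of ghom M N : {pred N} := fun v => `[< exists u, v = f u >].

Lemma im_zmod : zmod_closed (im_pred f).
Proof.
split; first by apply/asboolP; exists 0; rewrite raddf0.
move=> u v /asboolP [u' ->] /asboolP [v' ->]; apply/asboolP.
by exists (u' - v'); rewrite raddfB.
Qed.

HB.instance Definition _ :=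
  GRing.isZmodClosed.Build N (im_pred f) im_zmod.

Definition coker_type := Quotient.quot (im_pred f).
HB.instance Definition _ := GRing.Zmodule.on coker_type.
HB.instance Definition _ := EqQuotient.on coker_type.

Definition coker_pi (v : N) : coker_type := \pi_(Quotient.quot (im_pred f)) v.

Lemma coker_piB : {morph coker_pi : u v / u - v}.
Proof. by move=> u v; rewrite /coker_pi raddfB. Qed.

Lemma coker_pi0 v : coker_pi v = 0 <-> exists u, v = f u.
Proof.
have -> : 0 = coker_pi 0 by rewrite /coker_pi raddf0.
rewrite /coker_pi; split=> [/eqP|[u E]].
  by rewrite -Quotient.idealrBE subr0 => /asboolP.
by apply/eqP; rewrite -Quotient.idealrBE subr0; apply/asboolP; exists u.
Qed.

Lemma coker_pi_eq u v : coker_pi u = coker_pi v <-> exists w, u - v = f w.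
Proof.
rewrite -coker_pi0 coker_piB; split=> [->|/eqP]; first by rewrite subrr.
by rewrite subr_eq0 => /eqP.
Qed.

Lemma coker_reprK (q : coker_type) : coker_pi (repr q) = q.
Proof. exact: reprK. Qed.

Definition coker_scale (p : coordring K) (q : coker_type) : coker_type :=
  coker_pi (p *: repr q).

Lemma coker_piZ p v : coker_scale p (coker_pi v) = coker_pi (p *: v).
Proof.
apply/coker_pi_eq.
have /coker_pi_eq [w E] := coker_reprK (coker_pi v).
by exists (p *: w); rewrite -scalerBr E linearZ.
Qed.

Lemma coker_piD : {morph coker_pi : u v / u + v}.
Proof. by move=> u v; rewrite /coker_pi raddfD. Qed.

Lemma coker_scaleA a b q : coker_scale a (coker_scale b q) = coker_scale (a * b) q.
Proof. by rewrite -[q]coker_reprK !coker_piZ scalerA. Qed.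
Lemma coker_scale1 : left_id 1 coker_scale.
Proof. by move=> q; rewrite -[q]coker_reprK !coker_piZ scale1r. Qed.
Lemma coker_scaleDr : right_distributive coker_scale +%R.
Proof.
move=> a q r; rewrite -[q]coker_reprK -[r]coker_reprK -coker_piD !coker_piZ.
by rewrite scalerDr coker_piD.
Qed.
Lemma coker_scaleDl q : {morph coker_scale^~ q : a b / a + b}.
Proof.
by move=> a b; rewrite -[q]coker_reprK !coker_piZ scalerDl coker_piD.
Qed.

HB.instance Definition _ := GRing.Zmodule_isLmodule.Build (coordring K) coker_type
  coker_scaleA coker_scale1 coker_scaleDr coker_scaleDl.

Definition coker_piece (j : int) : set coker_type := fun q =>
  exists2 v : N, gpiece j v & q = coker_pi v.

Lemma coker_pi_sum (s : seq int) (c : int -> N) :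
  coker_pi (\sum_(j <- s) c j) = \sum_(j <- s) coker_pi (c j).
Proof.
elim: s => [|j s IH]; first by rewrite !big_nil; apply/coker_pi0; exists 0; rewrite raddf0.
by rewrite !big_cons coker_piD IH.
Qed.

Lemma coker_fam : gfamily coker_piece.
Proof.
have hN := gpiece_fam N.
split=> [j|j _ _ [u hu ->] [v hv ->]|k j p _ hp [u hu ->]|s c us hc].
- by exists 0; [exact: gfam0 hN j | apply/esym/coker_pi0; exists 0; rewrite raddf0].
- by exists (u - v); [exact: gfamB hN _ _ _ hu hv | rewrite coker_piB].
- by exists (p *: u); [exact: gfamZ hN _ _ _ _ hp hu | rewrite -coker_piZ].
have /choice [b hb] j : exists v, gpiece j v /\ c j = coker_pi v.
  by have [v] := hc j; exists v.
rewrite (eq_bigr (fun j => coker_pi (b j))) => [|j _]; last by case: (hb j).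
rewrite -coker_pi_sum => /coker_pi0 [u].
have [t [e [ut he ->]]] := gpiece_span u; rewrite raddf_sum => E j js.
have [_ ->] := hb j; apply/coker_pi0.
rewrite (dfree_eq (gfam0 hN) (gfamB hN) (gfam_free hN) us ut _ _ E js).
- by case: ifP => _; [exists (e j) | exists 0; rewrite raddf0].
- by move=> i; case: (hb i).
- by move=> i; apply: ghom_piece.
Qed.

Lemma coker_span q : dsum coker_piece q.
Proof.
rewrite -[q]coker_reprK; have [s [c [us hc ->]]] := gpiece_span (repr q).
exists s, (fun j => coker_pi (c j)); split=> //; last exact: coker_pi_sum.
by move=> j; exists (c j).
Qed.

Definition coker : gmod K := GMod coker_fam coker_span.

End Coker.

(* Homogeneous of degree [k], for an integer [k]; only [0] when [k < 0]. *)
Definition ihomog (K : fieldType) (k : int) (p : coordring K) : Prop :=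
  forall m, m \in msupp p -> (mdeg m)%:Z = k.

Section IHomog.
Variable K : fieldType.
Implicit Types p q : coordring K.

Lemma ihomogP (k : nat) p : ihomog k%:Z p <-> p \is k.-homog.
Proof.
split=> [h|/dhomogP h m /h ->] //.
by apply/dhomogP => m /h [].
Qed.

Lemma ihomog0 k : ihomog k (0 : coordring K).
Proof. by move=> m; rewrite msupp0. Qed.

Lemma ihomogB k p q : ihomog k p -> ihomog k q -> ihomog k (p - q).
Proof. by move=> hp hq m /msuppB_le; rewrite mem_cat => /orP[/hp|/hq]. Qed.

Lemma ihomogM k l p q : ihomog k p -> ihomog l q -> ihomog (k + l) (p * q).
Proof.
move=> hp hq m /msuppM_le /allpairsP [[m1 m2] /= [/hp h1 /hq h2 ->]].
by rewrite mdegD PoszD h1 h2.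
Qed.

Lemma ihomogX k n p : ihomog k p -> ihomog (n%:Z * k) (p ^+ n).
Proof.
move=> hp; elim: n => [|n IH]; first by rewrite mul0r; apply/ihomogP/dhomog1.
by rewrite exprS -add1n PoszD mulrDl mul1r; apply: ihomogM.
Qed.

Lemma ihomog_var (i : 'I_4) : ihomog 1 ('X_i : coordring K).
Proof. by apply/(ihomogP 1); rewrite dhomogX; apply/eqP; apply: mdeg1. Qed.

Lemma ihomog_sum (I : eqType) (r : seq I) k (F : I -> coordring K) :
  (forall i, i \in r -> ihomog k (F i)) -> ihomog k (\sum_(i <- r) F i).
Proof.
move=> h; rewrite big_seq; apply: big_ind => //; first exact: ihomog0.
move=> p q hp hq; rewrite -[q]opprK; apply: ihomogB => //.
by rewrite -sub0r; apply: ihomogB => //; apply: ihomog0.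
Qed.

Lemma ihomog_free : dfree (fun j p => ihomog j p : Prop).
Proof.
move=> s c us hc E j js; apply/mpolyP => m; rewrite mcoeff0.
have [h|] := boolP (m \in msupp (c j)); last exact: memN_msupp_eq0.
have := congr1 (mcoeff m) E; rewrite raddf_sum /= mcoeff0.
rewrite (bigD1_seq j) //= big1 ?addr0 // => i /eqP ij.
apply/eqP; rewrite mcoeff_eq0; apply/negP => /hc; rewrite (hc j m h).
by move=> e; apply: ij.
Qed.

End IHomog.

Record gens := Gens { grank : nat; gdeg : 'I_grank -> int }.

(* [twist n a] stands for [R^n(a)], whose generators have degree [- a]. *)
Definition twist (n : nat) (a : int) : gens := @Gens n (fun=> - a).

Definition gens_add (F G : gens) : gens :=
  Gens (fun i : 'I_(grank F + grank G) =>
    match split i with inl i1 => gdeg i1 | inr i2 => gdeg i2 end).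

Section Free.
Variables (K : fieldType) (F : gens).

Definition free_piece (j : int) : set 'cV[coordring K]_(grank F) := fun v =>
  forall i, ihomog (j - gdeg i) (v i 0).

Lemma free_fam : gfamily free_piece.
Proof.
split=> [j i|j u v hu hv i|k j p u hp hu i|s c us hc E j js].
- by rewrite mxE; apply: ihomog0.
- by rewrite !mxE; apply: ihomogB.
- rewrite mxE addrAC addrC; apply: ihomogM; last exact: hu.
  exact/ihomogP.
apply/colP => i; rewrite mxE; have D : injective (fun j => j - gdeg i).
  by move=> a b /addIr.
pose c' k := c (k + gdeg i) i 0.
have := @ihomog_free K [seq j - gdeg i | j <- s] c'; rewrite map_inj_uniq //.
move=> /(_ us) H; rewrite -[j](subrK (gdeg i)); apply: H.
- by move=> k; have := hc (k + gdeg i) i; rewrite addrK.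
- rewrite big_map; have := congr1 (fun v : 'cV_ _ => v i 0) E.
  rewrite summxE mxE => E'; rewrite -[RHS]E'.
  by apply: eq_bigr => k _; rewrite /c' subrK.
- by apply: map_f.
Qed.

Lemma free_span v : dsum free_piece v.
Proof.
have [h0 hB] := (gfam0 free_fam, gfamB free_fam).
rewrite [v]matrix_sum_delta; apply: dsum_sum => // i; apply: dsum_sum => // o.
rewrite [o]ord1.
rewrite (pihomog_partitionE (mf := mdeg) (leqnn (mmeasure mdeg (v i 0)))).
rewrite scaler_suml; apply: dsum_sum => // k.
apply: (@dsum1 _ _ h0 (k%:Z + gdeg i)) => l; rewrite !mxE.
case: eqP => [->|_] /=; last by rewrite mulr0; apply: ihomog0.
rewrite addrK mulr1; apply/ihomogP/pihomogP.
Qed.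

Definition freemod : gmod K := GMod free_fam free_span.

End Free.
Arguments freemod K F : clear implicits.

Section MxHom.
Variables (K : fieldType) (F G : gens).
Variable A : 'M[coordring K]_(grank G, grank F).

(* The entries for which [v |-> A *m v] preserves degrees. *)
Definition mx_homog : Prop :=
  forall i k, ihomog (gdeg k - gdeg i) (A i k).
Hypothesis hA : mx_homog.

Definition mx_fun : freemod K F -> freemod K G := fun v => A *m v.

Lemma mx_fun_linear : linear mx_fun.
Proof. by move=> a u v; rewrite /mx_fun mulmxDr -scalemxAr. Qed.
HB.instance Definition _ :=
  GRing.isLinear.Build (coordring K) (freemod K F) (freemod K G) _ mx_fun mx_fun_linear.

Lemma mx_fun_piece j u : gpiece j u -> gpiece j (mx_fun u).
Proof.
move=> hu i; rewrite mxE; apply: ihomog_sum => k _.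
have -> : j - gdeg i = (gdeg k - gdeg i) + (j - gdeg k).
  by rewrite [RHS]addrC subrKA.
by apply: ihomogM; [apply: hA | apply: hu].
Qed.

Definition mx_ghom : ghom (freemod K F) (freemod K G) := GHom mx_fun_piece.

End MxHom.

Definition exact_at (K : fieldType) (M N P : gmod K)
    (f : ghom M N) (g : ghom N P) : Prop :=
  forall v : N, g v = 0 <-> exists u, v = f u.

Record ideal (K : fieldType) := Ideal {
  ideal_set :> coordring K -> Prop;
  ideal0 : ideal_set 0;
  idealD : forall a b, ideal_set a -> ideal_set b -> ideal_set (a + b);
  idealM : forall a b, ideal_set b -> ideal_set (a * b) }.

Section Ideals.
Variable K : fieldType.
Local Notation R := (coordring K).

Definition gen_set (S : set R) : set R := fun p =>
  exists (s : seq (R * R)), (forall x, x \in s -> S x.2) /\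
    p = \sum_(x <- s) x.1 * x.2.

Lemma gen_set0 S : gen_set S 0.
Proof. by exists [::]; rewrite big_nil. Qed.
Lemma gen_setD S a b : gen_set S a -> gen_set S b -> gen_set S (a + b).
Proof.
move=> [s [hs ->]] [t [ht ->]]; exists (s ++ t); rewrite big_cat; split=> // x.
by rewrite mem_cat => /orP[/hs|/ht].
Qed.
Lemma gen_setM S a b : gen_set S b -> gen_set S (a * b).
Proof.
move=> [s [hs ->]]; exists [seq (a * x.1, x.2) | x <- s]; split.
  by move=> x /mapP [y /hs hy ->].
by rewrite big_map mulr_sumr; apply: eq_bigr => x _; rewrite mulrA.
Qed.

Definition ideal_gen (S : set R) : ideal K :=
  Ideal (gen_set0 S) (@gen_setD S) (@gen_setM S).

Definition ideal_exp (I : ideal K) (d : nat) : ideal K :=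
  ideal_gen [set p | exists a : 'I_d -> R, (forall i, I (a i)) /\ p = \prod_i a i].

(* The irrelevant maximal ideal [(x, y, z, t)]. *)
Definition irrelevant : ideal K := ideal_gen [set p | exists i : 'I_4, p = 'X_i].

End Ideals.
Arguments irrelevant K : clear implicits.

(* [... -> F_2 -> F_1 -> F_0 -> M -> 0] is exact and the image of each
   [F_(i+1) -> F_i] lies in [(x,y,z,t) F_i]. *)
Definition has_min_free_res (K : fieldType) (M : gmod K) (F : nat -> gens) : Prop :=
  exists (e : ghom (freemod K (F 0%N)) M)
         (d : forall i, ghom (freemod K (F i.+1)) (freemod K (F i))),
    [/\ forall v : M, exists u, v = e u,
        exact_at (d 0%N) e,
        forall i, exact_at (d i.+1) (d i) &
        forall i (u : freemod K (F i.+1)) r, irrelevant K ((d i u : 'cV_ _) r 0)].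

Definition ratfun (K : fieldType) := {fraction coordring K}.

Section RatFun.
Variable K : fieldType.
Local Notation R := (coordring K).
HB.instance Definition _ := GRing.Field.on (ratfun K).

Definition ratfun_scale (p : R) (u : ratfun K) : ratfun K := p%:F * u.
Lemma ratfun_scaleA a b u :
  ratfun_scale a (ratfun_scale b u) = ratfun_scale (a * b) u.
Proof. by rewrite /ratfun_scale mulrA rmorphM. Qed.
Lemma ratfun_scale1 : left_id 1 ratfun_scale.
Proof. by move=> u; rewrite /ratfun_scale rmorph1 mul1r. Qed.
Lemma ratfun_scaleDr : right_distributive ratfun_scale +%R.
Proof. by move=> a u v; rewrite /ratfun_scale mulrDr. Qed.
Lemma ratfun_scaleDl u : {morph ratfun_scale^~ u : a b / a + b}.
Proof. by move=> a b; rewrite /ratfun_scale rmorphD mulrDl. Qed.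
HB.instance Definition _ := GRing.Zmodule_isLmodule.Build R (ratfun K)
  ratfun_scaleA ratfun_scale1 ratfun_scaleDr ratfun_scaleDl.

(* For [f] homogeneous of degree [e]: the elements of degree [j] of the
   localization [J_f], inside the fraction field of [R].  If [C] is the closed
   subscheme of P^3 defined by [J], this is the group of sections of
   [I_C(j)], the sheaf associated with [J(j)], over the affine open [D_+(f)]. *)
Definition sect (J : ideal K) (f : R) (e : nat) (j : int) : set (ratfun K) :=
  fun u => exists n a, [/\ J a, ihomog (j + n%:Z * e%:Z) a & u = a%:F / (f ^+ n)%:F].

Section Sect.
Variables (J : ideal K) (f : R) (e : nat).
Hypotheses (f0 : f != 0) (hf : ihomog e%:Z f).

Lemma fpow0 n : (f ^+ n)%:F != 0 :> ratfun K.
Proof. by rewrite tofrac_eq0 expf_neq0. Qed.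

Lemma sect_ext j n m a : J a -> ihomog (j + n%:Z * e%:Z) a -> (n <= m)%N ->
  exists b, [/\ J b, ihomog (j + m%:Z * e%:Z) b &
    a%:F / (f ^+ n)%:F = b%:F / (f ^+ m)%:F :> ratfun K].
Proof.
move=> Ja ha nm; exists (f ^+ (m - n) * a); split.
- exact: idealM.
- have -> : j + m%:Z * e%:Z = (m - n)%N%:Z * e%:Z + (j + n%:Z * e%:Z).
    by rewrite addrCA -mulrDl -PoszD subnK.
  by apply: ihomogM => //; apply: ihomogX.
- rewrite -{2}(subnK nm) exprD !rmorphM /= -mulf_div divff ?mul1r //.
  exact: fpow0.
Qed.

Lemma sect0 j : sect J f e j 0.
Proof. by exists 0%N, 0; split; [exact: ideal0|exact: ihomog0|rewrite rmorph0 mul0r]. Qed.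

Lemma sectB j u v : sect J f e j u -> sect J f e j v -> sect J f e j (u - v).
Proof.
move=> [n [a [Ja ha ->]]] [m [b [Jb hb ->]]].
have [a' [Ja' ha' ->]] := sect_ext Ja ha (leq_addr m n).
have [b' [Jb' hb' ->]] := sect_ext Jb hb (leq_addl n m).
exists (n + m)%N, (a' - b'); split; last by rewrite rmorphB mulrBl.
  by rewrite -mulN1r; apply: idealD => //; apply: idealM.
exact: ihomogB.
Qed.

Lemma sectZ (k : nat) j p u :
  p \is k.-homog -> sect J f e j u -> sect J f e (j + k%:Z) (p *: u).
Proof.
move=> /ihomogP hp [n [a [Ja ha ->]]]; exists n, (p * a); split.
- exact: idealM.
- by rewrite addrAC addrC; apply: ihomogM.
- by rewrite rmorphM -mulrA.
Qed.

Lemma sect_free : dfree (sect J f e).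
Proof.
move=> s c us hc.
have /choice [g hg] j : exists na : nat * R,
    [/\ J na.2, ihomog (j + na.1%:Z * e%:Z) na.2 & c j = na.2%:F / (f ^+ na.1)%:F].
  by have [n [a h]] := hc j; exists (n, a).
pose N := (\max_(j <- s) (g j).1)%N.
have leN j : j \in s -> ((g j).1 <= N)%N by move=> js; apply: leq_bigmax_seq.
have /choice [b hb] j : exists b, ihomog (j + N%:Z * e%:Z) b /\
    (j \in s -> c j = b%:F / (f ^+ N)%:F).
  have [js|_] := boolP (j \in s); last by exists 0; split=> //; apply: ihomog0.
  have [Ja ha ->] := hg j; have [b [_ hb E]] := sect_ext Ja ha (leN _ js).
  by exists b.
rewrite big_seq (eq_bigr (fun j => (b j)%:F / (f ^+ N)%:F)); last first.
  by move=> j js; have [_ ->] := hb j.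
rewrite -big_seq -mulr_suml -rmorph_sum => /eqP.
rewrite mulf_eq0 invr_eq0 (negbTE (fpow0 N)) orbF tofrac_eq0 => /eqP E j js.
pose D := N%:Z * e%:Z.
have [_ ->] := hb j; last by [].
have := @ihomog_free K [seq i + D | i <- s] (fun i => b (i - D)).
rewrite map_inj_uniq; last exact: addIr.
move=> /(_ us) H; have := H _ _ (j + D); rewrite addrK => -> //.
- by rewrite rmorph0 mul0r.
- by move=> i; have [h _] := hb (i - D); move: h; rewrite -/D subrK.
- by rewrite big_map -[RHS]E; apply: eq_bigr => i _; rewrite addrK.
- exact: map_f.
Qed.

End Sect.

Lemma var_neq0 (i : 'I_4) : 'X_i != 0 :> R.
Proof. by rewrite -msupp_eq0 msuppX. Qed.

Lemma ihomog_var2 (i k : 'I_4) : ihomog 2 ('X_i * 'X_k : R).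
Proof. by apply: (@ihomogM _ 1 1); apply: ihomog_var. Qed.

Section Cech.
Variable J : ideal K.

(* Cech complex of the sheaves [I_C(j)], for the covering of P^3 by the
   [D_+('X_i)]: cochains of degree 0 and cocycles of degree 1.  Since [R] is a
   domain, all restriction maps are inclusions in the fraction field. *)
Definition cech0 (j : int) : set {ffun 'I_4 -> ratfun K} := fun c =>
  forall i, sect J 'X_i 1 j (c i).

Definition cocycle1 (j : int) : set {ffun 'I_4 * 'I_4 -> ratfun K} := fun s =>
  (forall i k, sect J ('X_i * 'X_k) 2 j (s (i, k))) /\
  (forall i k l, s (i, k) + s (k, l) = s (i, l)).

Lemma cech0_fam : gfamily cech0.
Proof.
split=> [j i|j u v hu hv i|k j p u hp hu i|s c us hc E j js].
- by rewrite ffunE; apply: sect0.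
- rewrite !ffunE; apply: sectB => //; [exact: var_neq0 | exact: ihomog_var].
- by rewrite ffunE; apply: sectZ.
apply/ffunP => i; rewrite ffunE.
apply: (sect_free (var_neq0 i) (@ihomog_var K i) us (c := fun j => c j i)) js.
  by move=> k; apply: hc.
by have := congr1 (fun u : {ffun _} => u i) E; rewrite sum_ffunE ffunE.
Qed.

Lemma cocycle1_fam : gfamily cocycle1.
Proof.
have n0 (i k : 'I_4) : 'X_i * 'X_k != 0 :> R by rewrite mulf_neq0 ?var_neq0.
split=> [j|j u v [hu eu] [hv ev]|k j p u hp [hu eu]|s c us hc E j js].
- by split=> [i k|i k l]; rewrite !ffunE ?addr0 //; apply: sect0.
- split=> [i k|i k l]; rewrite !ffunE; last by rewrite addrACA -opprD eu ev.
  by apply: sectB => //; apply: ihomog_var2.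
- split=> [i l|i l m]; rewrite !ffunE; last by rewrite -scalerDr eu.
  exact: sectZ.
apply/ffunP => -[i k]; rewrite ffunE.
apply: (sect_free (n0 i k) (@ihomog_var2 i k) us (c := fun j => c j (i, k))) js.
  by move=> l; case: (hc l).
by have := congr1 (fun u : {ffun _} => u (i, k)) E; rewrite sum_ffunE ffunE.
Qed.

Definition cech_d (c : {ffun 'I_4 -> ratfun K}) :
    {ffun 'I_4 * 'I_4 -> ratfun K} := [ffun p => c p.2 - c p.1].

Lemma cech_d_linear : linear cech_d.
Proof.
move=> a u v; apply/ffunP => p; rewrite !ffunE scalerBr opprD.
by rewrite addrACA.
Qed.
HB.instance Definition _ := GRing.isLinear.Build R
  {ffun 'I_4 -> ratfun K} {ffun 'I_4 * 'I_4 -> ratfun K} _ cech_d cech_d_linear.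

Lemma sect_restr j (i k : 'I_4) u :
  sect J 'X_i 1 j u -> sect J ('X_i * 'X_k) 2 j u.
Proof.
move=> [n [a [Ja ha ->]]]; exists n, ('X_k ^+ n * a); split.
- exact: idealM.
- have -> : j + n%:Z * 2%:Z = n%:Z * 1 + (j + n%:Z * 1%:Z).
    by rewrite addrCA -mulrDr.
  by apply: ihomogM => //; apply: ihomogX; apply: ihomog_var.
- rewrite exprMn ['X_i ^+ n * _]mulrC !tofracM -mulf_div divff ?mul1r //.
  by rewrite tofrac_eq0 expf_neq0 ?var_neq0.
Qed.

Lemma cech_d_piece j c : cech0 j c -> cocycle1 j (cech_d c).
Proof.
move=> h; split=> [i k|i k l]; rewrite !ffunE /=; last by rewrite addrC subrKA.
apply: sectB.
- by rewrite mulf_neq0 ?var_neq0.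
- exact: ihomog_var2.
- by rewrite mulrC; apply: sect_restr.
- exact: sect_restr.
Qed.

(* [C^0 = \bigoplus_j C^0(I_C(j))] and [Z^1 = \bigoplus_j Z^1(I_C(j))]. *)
Definition C0 : gmod K := gsub cech0_fam.
Definition Z1 : gmod K := gsub cocycle1_fam.

Lemma delta_mem (c : C0) : cech_d (val c) \in gsub_pred cocycle1_fam.
Proof.
case: c => c /= /asboolP [s [b [us hb ->]]]; apply/asboolP.
by exists s, (fun j => cech_d (b j)); split=> //;
  [move=> j; apply: cech_d_piece | rewrite raddf_sum].
Qed.

Definition delta_fun (c : C0) : Z1 := GSub (delta_mem c).

Lemma delta_linear : linear delta_fun.
Proof.
by move=> a u v; apply: val_inj; rewrite /= linearP.
Qed.
HB.instance Definition _ := GRing.isLinear.Build R C0 Z1 _ delta_fun delta_linear.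

Lemma delta_piece j c : gpiece j c -> gpiece j (delta_fun c).
Proof. exact: cech_d_piece. Qed.

Definition delta : ghom C0 Z1 := GHom delta_piece.

(* [\bigoplus_j H^1(P^3, I_C(j))]. *)
Definition hartshorne_rao : gmod K := coker delta.

End Cech.
End RatFun.

Section Curve.
Variable K : fieldType.
Local Notation R := (coordring K).

Local Notation x := ('X_0 : R).
Local Notation y := ('X_1 : R).
Local Notation z := ('X_2 : R).
Local Notation t := ('X_3 : R).

Definition idealJ (d : nat) : ideal K :=
  ideal_gen [set p | p = x * z - y * t \/
                     ideal_exp (ideal_gen [set y; z]) d p].

Definition bidiag (a b : R) (i : nat) : 'M[R]_(i, i.-1) :=
  \matrix_(r, c) if r == c :> nat then a else if r == c.+1 :> nat then b else 0.

Definition matM := bidiag y (- x).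
Definition matN := bidiag z (- t).

Definition presentation (d : nat) : 'M[R]_(d.-1, d + d) :=
  row_mx (matN d)^T (matM d)^T.

Lemma presentation_homog d :
  @mx_homog K (twist (d + d) (-1)) (twist d.-1 0) (presentation d).
Proof.
move=> i k; rewrite /= opprK subr0 mxE.
have N p : ihomog 1 p -> ihomog 1 (- p : R).
  by move=> h; rewrite -sub0r; apply: ihomogB => //; apply: ihomog0.
have X (r : 'I_4) : ihomog 1 ('X_r : R) by apply: ihomog_var.
case: split => r; rewrite !mxE; do 2?case: ifP => _;
  by [apply: ihomog0 | apply: X | apply: N; apply: X].
Qed.

(* [[N_d^t M_d^t] : R^(2d)(-1) -> R^(d-1)], acting on column vectors. *)
Definition presentation_map (d : nat) :
    ghom (freemod K (twist (d + d) (-1))) (freemod K (twist d.-1 0)) :=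
  mx_ghom (@presentation_homog d).

End Curve.
Arguments idealJ K d : clear implicits.
Arguments presentation_map K d : clear implicits.

(* Main.v *)
From HB Require Import structures.
Require Import Defs.
From mathcomp Require Import all_boot all_order all_algebra.
From mathcomp Require Import boolp classical_sets.
From mathcomp Require Import mpoly ring zify.

Set Implicit Arguments.
Unset Strict Implicit.
Unset Printing Implicit Defensive.

Import Order.TTheory GRing.Theory Num.Theory.
Local Open Scope ring_scope.

(** Write [q = x z - y t], and let [w] be the rational function [y / x = z / t]
    on the quadric [q = 0].

    The module.  The ideal [J] contains [y^d] and [z^d], so it becomes the unit
    ideal on the charts [y <> 0] and [z <> 0]; on the charts [x <> 0] and
    [t <> 0] the quotient by [J] is free on [1, w, ..., w^(d-1)] over the
    functions of [x] and [t].  This is seen through the ring map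
    [phi : R -> R[w]], [y |-> x w], [z |-> t w], which kills [q], sends [J] into
    [(w^d)] ([phi_idealJ]) and, after evaluation of [w], is the identity of the
    localization modulo [J] ([loc_ev_phi]).  As [H^1(P^3, O(j)) = 0]
    ([cech_split]), a cocycle of [J] is the difference of two functions on the
    charts [x] and [t] which agree modulo [J] on the overlap, hence have the
    same coefficients [a_k] on the [w^k]; these are polynomials.  So the module
    is generated by the classes of [w, ..., w^(d-1)] ([cocycle_cochain]): the
    term [a_0] extends to all charts.  The resulting map [Psi] from [R^(d-1)]
    sends the [r]-th basis vector to the class of [w^(d-1-r)], which explains the
    relations [z f_r = t f_(r-1)] and [y f_r = x f_(r-1)] encoded by [N_d^t] and
    [M_d^t].  There are no others: a combination of the [w^k] with zero class
    agrees modulo [(w^d)] with [phi g] for some polynomial [g]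
    ([phi_sum_of_loc]), and modulo the relations the action of [phi g] on the
    generator [1], which is zero in the module, is that of [g]
    ([in_beta_phi], [in_beta_phi_sum]).

    The resolution.  With an auxiliary variable [s], an element [(p, q)] of
    [R^(2d)] is a pair of polynomials [P, Q] of degree less than [d], and
    [beta (p, q)] lists the inner coefficients of [(z s - t) P + (y s - x) Q].
    Its kernel contains the Koszul syzygies ([alphap], [alphaq]) and the
    elements ([kergen_p], [kergen_q]) lifting the forms [x^i t^(d-i)], for
    [i = 0, ..., d].  The constant coefficient of a kernel element is
    [- (t p_0 + x q_0)], and an induction on the powers of [(x, t)] shows that
    it lies in [(x, t)^d + (q)] ([xtpow_shift], [beta_head]); subtracting
    combinations of the lifts reduces it to a multiple of [q], and then only
    Koszul syzygies remain ([beta_exact]).  The second half of the resolution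
    is that of the ideal [(x, t)^d] of [R / (q)]: its syzygies are generated by
    [t g_(i+1) = x g_i] and [z g_(i+1) = y g_i] ([syzygies_qform]), whose
    lifts need the corrections [corr_tx] and [corr_zy], and the relations among
    these are again of Koszul type ([relmap_exact]).  All exactness statements
    thus reduce to the regularity of pairs of variables, of [q], and of [y, z]
    modulo powers of [(x, t)].  The resolution is minimal because every matrix
    entry has positive degree. *)

(** * Regular sequences and the powers of the ideal (x, t) *)

Section Monomials.
Variable K : fieldType.
Local Notation R := (coordring K).
Implicit Types p q a b c h : R.

Local Notation x := ('X_0 : R).
Local Notation y := ('X_1 : R).
Local Notation z := ('X_2 : R).
Local Notation t := ('X_3 : R).

Definition mrestrict (P : pred 'X_{1..4}) (p : R) : R :=
  \sum_(m <- msupp p | P m) p@_m *: 'X_[m].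

Lemma mcoeff_mrestrict P p m : (mrestrict P p)@_m = if P m then p@_m else 0.
Proof.
rewrite raddf_sum /=.
have [mp|mp] := boolP (m \in msupp p); last first.
  rewrite (memN_msupp_eq0 mp) if_same big_seq_cond big1 // => k /andP[kp _].
  rewrite mcoeffZ mcoeffX; case: eqP => [E|_]; last by rewrite mulr0.
  by rewrite -E kp in mp.
rewrite big_mkcond (bigD1_seq m) ?msupp_uniq //= big1 ?addr0.
  by case: ifP; rewrite ?mcoeffZ ?mcoeffX ?eqxx ?mulr1.
move=> k km; case: ifP => _ //.
by rewrite mcoeffZ mcoeffX (negbTE km) mulr0.
Qed.

Lemma msupp_mrestrict P p m : (m \in msupp (mrestrict P p)) = P m && (m \in msupp p).
Proof. by rewrite !mcoeff_msupp mcoeff_mrestrict; case: (P m); rewrite ?eqxx. Qed.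

Lemma mrestrict_split P p : p = mrestrict P p + mrestrict (predC P) p.
Proof.
by apply/mpolyP => m; rewrite mcoeffD !mcoeff_mrestrict /=; case: (P m); rewrite ?addr0 ?add0r.
Qed.

Lemma ihomog_mrestrict k P p : ihomog k p -> ihomog k (mrestrict P p).
Proof. by move=> h m; rewrite msupp_mrestrict => /andP[_ /h]. Qed.

Lemma mnm_addXn (i j : 'I_4) n m : (m + U_(i) *+ n)%MM j = (m j + (i == j) * n)%N.
Proof. by rewrite mnmDE mulmnE mnm1E. Qed.

Lemma msupp_XnM (i : 'I_4) n p m :
  m \in msupp p -> (m + U_(i) *+ n)%MM \in msupp ('X_i ^+ n * p).
Proof. by rewrite mpolyXn mulrC addmC !mcoeff_msupp mcoeffMX. Qed.

Lemma msupp_XnM_inv (i : 'I_4) n p m : m \in msupp ('X_i ^+ n * p) ->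
  exists2 m', m' \in msupp p & m = (m' + U_(i) *+ n)%MM.
Proof.
rewrite mpolyXn mulrC (perm_mem (msuppMX _ _)) => /mapP [m' h ->].
by exists m'; rewrite // addmC.
Qed.

Lemma divXn (i : 'I_4) n p : (forall m, m \in msupp p -> (n <= m i)%N) ->
  exists p', p = 'X_i ^+ n * p'.
Proof.
move=> h; exists (\sum_(m <- msupp p) p@_m *: 'X_[m - U_(i) *+ n]).
rewrite {1}[p]mpolyE mulr_sumr big_seq [RHS]big_seq; apply: eq_bigr => m mp.
rewrite mpolyXn -scalerAr -mpolyXD addmC submK //; apply/mnm_lepP => j.
by rewrite mulmnE mnm1E; case: eqP => [<-|]; rewrite ?mul1n ?h.
Qed.

(** Each monomial of the two sides has exponent at least [k] in ['X_j], and
    multiplying by a power of ['X_i] does not affect that exponent, so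
    ['X_j ^+ k] divides [p]. *)
Lemma koszulXn (i j : 'I_4) n k p q : i != j ->
  'X_i ^+ n * p = 'X_j ^+ k * q ->
  exists c, p = 'X_j ^+ k * c /\ q = 'X_i ^+ n * c.
Proof.
move=> ij E.
have [m mp|c pE] := @divXn j k p.
  have : (m + U_(i) *+ n)%MM \in msupp ('X_j ^+ k * q).
    by rewrite -E; apply: msupp_XnM.
  case/msupp_XnM_inv => m' _ /(congr1 (fun m : 'X_{1..4} => m j)).
  by rewrite !mnm_addXn eqxx (negbTE ij) => /eqP; lia.
exists c; split=> //; apply: (@mulfI _ ('X_j ^+ k)).
  by rewrite expf_neq0 // var_neq0.
by rewrite -E pE mulrCA.
Qed.

Lemma koszulX (i j : 'I_4) p q : i != j -> 'X_i * p + 'X_j * q = 0 ->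
  exists c, p = - 'X_j * c /\ q = 'X_i * c.
Proof.
move=> ij /eqP; rewrite addr_eq0 -mulrN => /eqP E.
have [c [pE qE]] := @koszulXn i j 1 1 p (- q) ij E.
rewrite !expr1 in pE qE; exists (- c); split; first by rewrite pE mulrNN.
by rewrite mulrN -qE opprK.
Qed.

Lemma ihomog_divXn (i : 'I_4) n k p : ihomog (k + n%:Z) ('X_i ^+ n * p) -> ihomog k p.
Proof.
move=> h m mp; have := h _ (msupp_XnM i n mp).
rewrite mdegD mdegMn mdeg1 mul1n PoszD; exact: addIr.
Qed.

Definition qform : R := x * z - y * t.

Lemma qform_neq0 : qform != 0.
Proof.
apply/eqP => /(congr1 (mcoeff (U_(0%R) + U_(2%:R))%MM)).
rewrite mcoeffB -!mpolyXD !mcoeffX mcoeff0 eqxx.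
case: eqP => [|_]; last by rewrite subr0; move/eqP; rewrite oner_eq0.
by move/(congr1 (fun m : 'X_{1..4} => m 0%R)); rewrite !mnmDE !mnm1E.
Qed.

Definition xtdeg (m : 'X_{1..4}) : nat := (m 0%R + m 3%:R)%N.
(** Membership in the ideal [(x, t)^n], which is spanned by monomials. *)
Definition xtpow (n : nat) p := forall m, m \in msupp p -> (n <= xtdeg m)%N.

Lemma xtdegD m1 m2 : xtdeg (m1 + m2)%MM = (xtdeg m1 + xtdeg m2)%N.
Proof. by rewrite /xtdeg !mnmDE addnACA. Qed.

Lemma xtpow_var n p (i : 'I_4) : (i == 0) || (i == 3%:R) ->
  xtpow n p -> xtpow n.+1 ('X_i * p).
Proof.
move=> hi h m; rewrite -['X_i]expr1 => /msupp_XnM_inv [m' /h hm ->].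
rewrite xtdegD mulm1n; have : xtdeg U_(i) = 1%N; last by lia.
by case/orP: hi => /eqP ->; rewrite /xtdeg !mnm1E.
Qed.

Lemma xtpowD n p q : xtpow n p -> xtpow n q -> xtpow n (p + q).
Proof. by move=> hp hq m /msuppD_le; rewrite mem_cat => /orP[/hp|/hq]. Qed.

Lemma xtpow_mrestrict n p : xtpow n (mrestrict (fun m => n <= xtdeg m)%N p).
Proof. by move=> m; rewrite msupp_mrestrict => /andP[]. Qed.

Lemma mrestrict_eq0 (P : pred 'X_{1..4}) p :
  (forall m, m \in msupp p -> ~~ P m) -> mrestrict P p = 0.
Proof.
move=> h; apply/mpolyP => m; rewrite mcoeff_mrestrict mcoeff0; case: ifP => // Pm.
by apply/eqP; rewrite mcoeff_eq0; apply/negP => /h; rewrite Pm.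
Qed.

Lemma mrestrictD P p q : mrestrict P (p + q) = mrestrict P p + mrestrict P q.
Proof.
apply/mpolyP => m; rewrite mcoeffD !mcoeff_mrestrict mcoeffD.
by case: ifP; rewrite ?addr0.
Qed.

Lemma mrestrict_id (P : pred 'X_{1..4}) p : (forall m, m \in msupp p -> P m) -> mrestrict P p = p.
Proof.
move=> h; apply/mpolyP => m; rewrite mcoeff_mrestrict; case: ifP => // Pm.
by apply/esym/eqP; rewrite mcoeff_eq0; apply/negP => /h; rewrite Pm.
Qed.

(** [y, z] is a regular sequence modulo [(x, t)^n]: multiplication by [y] or [z]
    keeps the [(x, t)]-degree, so the part of degree less than [n] of the
    relation is an ordinary Koszul relation between truncations. *)
Lemma koszul_mod_xtpow n a b : xtpow n (z * a + y * b) ->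
  exists c, xtpow n (a - y * c) /\ xtpow n (b + z * c).
Proof.
move=> h; pose Q m := (n <= xtdeg m)%N.
have H (i : 'I_4) p : xtdeg U_(i) = 0%N ->
    mrestrict (predC Q) ('X_i * p) = 'X_i * mrestrict (predC Q) p.
  move=> i0; rewrite {1}(mrestrict_split Q p) mulrDr mrestrictD mrestrict_eq0 ?add0r; last first.
    move=> m; rewrite -['X_i]expr1 => /msupp_XnM_inv [m' + ->].
    by rewrite msupp_mrestrict => /andP[+ _]; rewrite /= /Q xtdegD mulm1n i0 addn0 negbK.
  apply: mrestrict_id => m; rewrite -['X_i]expr1 => /msupp_XnM_inv [m' + ->].
  by rewrite msupp_mrestrict => /andP[+ _]; rewrite /= /Q xtdegD mulm1n i0 addn0.
have yz0 : xtdeg U_(1) = 0%N /\ xtdeg U_(2) = 0%N by rewrite /xtdeg !mnm1E.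
have E : mrestrict (predC Q) (z * a + y * b) = 0.
  by apply: mrestrict_eq0 => m /h hm; rewrite /= negbK.
move: E; rewrite mrestrictD !H; try by case: yz0.
case/koszulX => // c [aE bE]; exists (- c); split.
  have -> : a - y * - c = mrestrict Q a by rewrite {1}(mrestrict_split Q a) aE; ring.
  exact: xtpow_mrestrict.
have -> : b + z * - c = mrestrict Q b by rewrite {1}(mrestrict_split Q b) bE; ring.
exact: xtpow_mrestrict.
Qed.

(** The form [q] is homogeneous of [(x, t)]-degree 1, so it acts injectively on
    the graded pieces of the [(x, t)]-adic filtration. *)
Lemma xtpow_qform_div n h : xtpow n.+1 (qform * h) -> xtpow n h.
Proof.
move=> qh; pose Q m := (n <= xtdeg m)%N.
rewrite (mrestrict_split Q h); apply: xtpowD; first exact: xtpow_mrestrict.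
suff -> : mrestrict (predC Q) h = 0 by move=> m; rewrite msupp0.
set g := mrestrict _ h; apply: (mulfI qform_neq0); rewrite mulr0.
rewrite -(@mrestrict_id (fun m => ~~ (n < xtdeg m)%N) (qform * g)); last first.
  move=> m /msuppM_le /allpairsP [[m1 m2] /= [h1 h2 ->]].
  move: h2; rewrite msupp_mrestrict /Q /= xtdegD => /andP[h2 _].
  have : xtdeg m1 = 1%N; last by lia.
  move: h1 => /msuppB_le; rewrite mem_cat -!mpolyXD !msuppX !inE.
  by case/orP => /eqP ->; rewrite /xtdeg !mnmDE !mnm1E.
apply: mrestrict_eq0 => m; rewrite negbK.
have -> : qform * g = qform * h - qform * mrestrict Q h.
  by rewrite -mulrBr {1}(mrestrict_split Q h) addrAC subrr add0r.
move/msuppB_le; rewrite mem_cat => /orP[/qh //|].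
have h1 : xtpow n (mrestrict Q h) by apply: xtpow_mrestrict.
have -> : qform * mrestrict Q h = x * (z * mrestrict Q h) - t * (y * mrestrict Q h).
  by rewrite /qform; ring.
have zQ : forall i, xtpow n ('X_i * mrestrict Q h).
  move=> i k; rewrite -['X_i]expr1 => /msupp_XnM_inv [k' /h1 hk ->].
  by rewrite xtdegD; lia.
by move=> /msuppB_le; rewrite mem_cat => /orP[] /xtpow_var; apply.
Qed.

Lemma xtpow_span n p : xtpow n p ->
  exists c : nat -> R, p = \sum_(i < n.+1) c i * (x ^+ i * t ^+ (n - i)).
Proof.
move=> hp; rewrite [p]mpolyE big_seq.
apply: (big_ind (fun p => exists c : nat -> R,
   p = \sum_(i < n.+1) c i * (x ^+ i * t ^+ (n - i)))).
- by exists (fun=> 0); rewrite big1 // => i _; rewrite mul0r.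
- move=> _ _ [c ->] [e ->]; exists (fun i => c i + e i).
  by rewrite -big_split; apply: eq_bigr => i _; rewrite mulrDl.
(* as much of x as available is split off, and t makes up the rest *)
move=> m /hp hm; pose i := minn n (m 0%R).
pose u : 'X_{1..4} := (U_(0%R) *+ i + U_(3%:R) *+ (n - i))%MM.
exists (fun k => if k == i then p@_m *: 'X_[m - u] else 0).
have hi : (i < n.+1)%N by rewrite /i; lia.
rewrite (bigD1 (Ordinal hi)) //= eqxx big1 ?addr0; last first.
  by move=> k; rewrite -val_eqE /= => /negbTE ->; rewrite mul0r.
rewrite !mpolyXn -mpolyXD -scalerAl -mpolyXD submK //.
rewrite /u; apply/mnm_lepP => k; rewrite mnmDE !mulmnE !mnm1E.
rewrite /i; case: (eqVneq 0 k) => [<-|_] /=.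
  by rewrite mul1n mul0n addn0 geq_minr.
case: eqP => [<-|_]; last by rewrite !mul0n.
rewrite mul0n add0n mul1n; move: hm; rewrite /xtdeg.
by move: (m 0%R) (m 3%:R) => a b; lia.
Qed.

End Monomials.

(** * The exact sequence, on sequences of coefficients *)

Section Strands.
Variable K : fieldType.
Local Notation R := (coordring K).

Local Notation x := ('X_0 : R).
Local Notation y := ('X_1 : R).
Local Notation z := ('X_2 : R).
Local Notation t := ('X_3 : R).

(** The coefficient of [s^(k+1)] in [(z s - t) P + (y s - x) Q], where [p] and [q]
    are the coefficients of [P] and [Q]; for [k < d - 1] it is the [k]-th entry of
    the presentation matrix applied to [(p, q)]. *)
Definition beta (p q : nat -> R) (k : nat) : R :=
  z * p k - t * p k.+1 + y * q k - x * q k.+1.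

(** With [alphaq], the Koszul syzygies of [z s - t] and [y s - x]: the inner
    coefficients of [(y s - x) E] and [- (z s - t) E]. *)
Definition alphap (e : nat -> R) (k : nat) : R := y * e k - x * e k.+1.
Definition alphaq (e : nat -> R) (k : nat) : R := t * e k.+1 - z * e k.

(** With [kergen_q], the quotients of [y^i z^(d-i) s^d - x^i t^(d-i)] by the regular
    sequence [z s - t], [y s - x]: all coefficients but the two extreme ones
    vanish, which puts the pair in the kernel of [beta]. *)
Definition kergen_p (d i k : nat) : R :=
  if (k < d - i)%N then x ^+ i * t ^+ (d - i.+1 - k) * z ^+ k else 0.
Definition kergen_q (d i k : nat) : R :=
  if (k < d - i)%N then 0 else z ^+ (d - i) * x ^+ (d.-1 - k) * y ^+ (k - (d - i)).

(** With [corr_zy]: if [g_i] is the kernel element [(kergen_p d i, kergen_q d i)],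
    the syzygies [t g_(i+1) - x g_i] and [z g_(i+1) - y g_i] of the forms
    [x^i t^(d-i)] modulo [q] lift to these Koszul syzygies. *)
Definition corr_tx (d i k : nat) : R :=
  if (k < d - i)%N then 0 else z ^+ (d - i.+1) * x ^+ (d - k) * y ^+ (k - (d - i)).
Definition corr_zy (d i k : nat) : R :=
  if (k < d - i)%N then - (x ^+ i * t ^+ (d - i.+1 - k) * z ^+ k) else 0.

Definition gammap d (c : nat -> R) k : R := \sum_(i < d.+1) c i * kergen_p d i k.
Definition gammaq d (c : nat -> R) k : R := \sum_(i < d.+1) c i * kergen_q d i k.

Definition shift1 (f : nat -> R) (i : nat) : R := if i is j.+1 then f j else 0.

Lemma beta_alpha e k : beta (alphap e) (alphaq e) k = 0.
Proof. by rewrite /beta /alphap /alphaq; ring. Qed.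

Lemma beta_kergen d i k : (i <= d)%N -> (k < d.-1)%N -> beta (kergen_p d i) (kergen_q d i) k = 0.
Proof.
move=> id; have [n dE] : exists n, d = (i + n)%N by exists (d - i)%N; lia.
subst d => kd.
rewrite /beta /kergen_p /kergen_q; have -> : (i + n - i = n)%N by lia.
case: (ltngtP k.+1 n) => h.
- have [r ->] : exists r, n = (k + r).+2 by exists (n - k.+2)%N; lia.
  have -> : (i + (k + r).+2 - i.+1 - k = r.+1)%N by lia.
  have -> : (i + (k + r).+2 - i.+1 - k.+1 = r)%N by lia.
  by rewrite !exprS; ring.
- have [r kE] : exists r, k = (n + r)%N by exists (k - n)%N; lia.
  subst k.
  have -> : ((i + n).-1 - (n + r) = ((i + n).-1 - (n + r).+1).+1)%N by lia.
  have -> : (n + r - n = r)%N by lia.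
  have -> : ((n + r).+1 - n = r.+1)%N by lia.
  by rewrite !exprS; ring.
- subst n; rewrite ?leqnn subnn.
  have -> : (i + k.+1 - i.+1 - k = 0)%N by lia.
  have [r iE] : exists r, i = r.+1 by exists i.-1; lia.
  subst i.
  have -> : ((r.+1 + k.+1).-1 - k.+1 = r)%N by lia.
  by rewrite !exprS; ring.
Qed.

Lemma beta_gamma d c k : (k < d.-1)%N -> beta (gammap d c) (gammaq d c) k = 0.
Proof.
move=> kd; rewrite /beta /gammap /gammaq !mulr_sumr -!sumrB -big_split -sumrB.
rewrite big1 // => i _; transitivity (c i * beta (kergen_p d i) (kergen_q d i) k).
  by rewrite /beta /=; ring.
by rewrite beta_kergen ?mulr0 // -ltnS.
Qed.

(** The head [t p_0 + x q_0] of a combination of the kernel elements thus recovers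
    the corresponding combination of the forms [x^i t^(d-i)]. *)
Lemma kergen_head d i : (0 < d)%N -> (i <= d)%N ->
  t * kergen_p d i 0 + x * kergen_q d i 0 = x ^+ i * t ^+ (d - i).
Proof.
rewrite /kergen_p /kergen_q => d0 id; case: (ltngtP i d) id => // [h|->] _.
  by rewrite subn_gt0 h subn0 -(subnSK h) !exprS; ring.
by rewrite subnn /= subn0 mul1r -{2}(prednK d0) exprS; ring.
Qed.

Lemma kergen_tx d i k : (i < d)%N -> (k < d)%N ->
  t * kergen_p d i.+1 k - x * kergen_p d i k = alphap (corr_tx d i) k /\
  t * kergen_q d i.+1 k - x * kergen_q d i k = alphaq (corr_tx d i) k.
Proof.
move=> id; have [n dE] : exists n, d = (i.+1 + n)%N by exists (d - i.+1)%N; lia.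
subst d => kd.
rewrite /alphap /alphaq /kergen_p /kergen_q /corr_tx.
have -> : (i.+1 + n - i = n.+1)%N by lia.
have -> : (i.+1 + n - i.+1 = n)%N by lia.
case: (ltngtP k n) => h.
- have [r ->] : exists r, n = (k + r).+1 by exists (n - k.+1)%N; lia.
  have -> : (k < (k + r).+2)%N by lia.
  have -> : (k.+1 < (k + r).+2)%N by lia.
  have -> : (i.+1 + (k + r).+1 - i.+2 - k = r)%N by lia.
  have -> : ((k + r).+1 - k = r.+1)%N by lia.
  by split; rewrite ?exprS; ring.
- have -> : (k < n.+1)%N = false by lia.
  have -> : (k.+1 < n.+1)%N = false by lia.
  have [r kE] : exists r, k = (n + r).+1 by exists (k - n.+1)%N; lia.
  subst k.
  have -> : ((i.+1 + n).-1 - (n + r).+1 = ((i.+1 + n) - (n + r).+2))%N by lia.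
  have -> : ((i.+1 + n) - (n + r).+1 = ((i.+1 + n) - (n + r).+2).+1)%N by lia.
  have -> : ((n + r).+1 - n = r.+1)%N by lia.
  have -> : ((n + r).+1 - n.+1 = r)%N by lia.
  have -> : ((n + r).+2 - n.+1 = r.+1)%N by lia.
  by split; rewrite ?exprS; ring.
- subst n; rewrite ltnSn ltnn !subnn.
  have -> : (i.+1 + k - k.+1 = i)%N by lia.
  have -> : ((i.+1 + k).-1 - k = i)%N by lia.
  by split; rewrite ?exprS; ring.
Qed.

Lemma kergen_zy d i k : (i < d)%N -> (k < d)%N ->
  z * kergen_p d i.+1 k - y * kergen_p d i k = alphap (corr_zy d i) k /\
  z * kergen_q d i.+1 k - y * kergen_q d i k = alphaq (corr_zy d i) k.
Proof.
move=> id; have [n dE] : exists n, d = (i.+1 + n)%N by exists (d - i.+1)%N; lia.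
subst d => kd.
rewrite /alphap /alphaq /kergen_p /kergen_q /corr_zy.
have -> : (i.+1 + n - i = n.+1)%N by lia.
have -> : (i.+1 + n - i.+1 = n)%N by lia.
case: (ltngtP k n) => h.
- have [r ->] : exists r, n = (k + r).+1 by exists (n - k.+1)%N; lia.
  have -> : (k < (k + r).+2)%N by lia.
  have -> : (k.+1 < (k + r).+2)%N by lia.
  have -> : (i.+1 + (k + r).+1 - i.+2 - k = r)%N by lia.
  have -> : ((k + r).+1 - k = r.+1)%N by lia.
  have -> : ((k + r).+1 - k.+1 = r)%N by lia.
  by split; rewrite ?exprS; ring.
- have -> : (k < n.+1)%N = false by lia.
  have -> : (k.+1 < n.+1)%N = false by lia.
  have [r kE] : exists r, k = (n + r).+1 by exists (k - n.+1)%N; lia.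
  subst k.
  have -> : ((n + r).+1 - n = r.+1)%N by lia.
  have -> : ((n + r).+1 - n.+1 = r)%N by lia.
  by split; rewrite ?exprS; ring.
- subst n; rewrite ltnSn ltnn !subnn.
  have -> : ((i.+1 + k).-1 - k = i)%N by lia.
  by split; rewrite ?exprS; ring.
Qed.

(** The presentation of the ideal [(x, t)^d] of [R / (q)]: the coefficient of
    [g_i] in [\sum_j f_j (t g_(j+1) - x g_j) + h_j (z g_(j+1) - y g_j)]. *)
Definition relmap (f h : nat -> R) (i : nat) : R :=
  t * shift1 f i - x * f i + (z * shift1 h i - y * h i).

Definition relcorr d (f h : nat -> R) (k : nat) : R :=
  \sum_(i < d) (f i * corr_tx d i k + h i * corr_zy d i k).

Lemma sum_relmap d f h (G : nat -> R) : f d = 0 -> h d = 0 ->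
  \sum_(i < d.+1) relmap f h i * G i =
  \sum_(i < d) (f i * (t * G i.+1 - x * G i) + h i * (z * G i.+1 - y * G i)).
Proof.
move=> fd hd.
have H (g : nat -> R) (a b : R) : g d = 0 ->
    \sum_(i < d.+1) (a * shift1 g i - b * g i) * G i =
    \sum_(i < d) g i * (a * G i.+1 - b * G i).
  move=> gd; under eq_bigr do rewrite mulrBl.
  rewrite sumrB big_ord_recl [X in _ - X]big_ord_recr /= mulr0 gd mulr0 mul0r.
  rewrite mul0r add0r addr0 -sumrB; apply: eq_bigr => i _.
  by rewrite /bump /= add1n; ring.
rewrite big_split -!H // -big_split; apply: eq_bigr => i _.
by rewrite /relmap mulrDl.
Qed.

Lemma gamma_relmap d f h k : f d = 0 -> h d = 0 -> (k < d)%N ->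
  gammap d (relmap f h) k = alphap (relcorr d f h) k /\
  gammaq d (relmap f h) k = alphaq (relcorr d f h) k.
Proof.
move=> fd hd kd; split.
- rewrite /gammap (@sum_relmap d f h (fun i => kergen_p d i k)) // /alphap /relcorr !mulr_sumr.
  rewrite -sumrB; apply: eq_bigr => i _.
  have [-> _] := kergen_tx (ltn_ord i) kd; have [-> _] := kergen_zy (ltn_ord i) kd.
  by rewrite /alphap; ring.
- rewrite /gammaq (@sum_relmap d f h (fun i => kergen_q d i k)) // /alphaq /relcorr !mulr_sumr.
  rewrite -sumrB; apply: eq_bigr => i _.
  have [_ ->] := kergen_tx (ltn_ord i) kd; have [_ ->] := kergen_zy (ltn_ord i) kd.
  by rewrite /alphaq; ring.
Qed.

(** Multiplying the two equations by suitable variables and adding eliminates one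
    unknown and leaves a multiple of [q]. *)
Lemma alpha_inj d e : (0 < d)%N ->
  (forall k, (k < d)%N -> alphap e k = 0 /\ alphaq e k = 0) ->
  forall k, (k <= d)%N -> e k = 0.
Proof.
move=> d0 h.
have H k : (k < d)%N -> e k = 0 /\ e k.+1 = 0.
  move=> /h [] hp hq; split; apply: (mulfI (@qform_neq0 K)); rewrite mulr0.
    transitivity (- t * alphap e k - x * alphaq e k).
      by rewrite /alphap /alphaq /qform; ring.
    by rewrite hp hq !mulr0 subr0.
  transitivity (- z * alphap e k - y * alphaq e k).
    by rewrite /alphap /alphaq /qform; ring.
  by rewrite hp hq !mulr0 subr0.
case=> [|k] kd; first by case: (H 0%N).
by case: (H k).
Qed.

Lemma gamma_head d c : (0 < d)%N ->
  t * gammap d c 0 + x * gammaq d c 0 =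
  \sum_(i < d.+1) c i * (x ^+ i * t ^+ (d - i)).
Proof.
move=> d0; rewrite /gammap /gammaq !mulr_sumr -big_split /=.
by apply: eq_bigr => i _; rewrite -(@kergen_head d i) //=; [ring | rewrite -ltnS].
Qed.

(** The syzygies of the monomials [x^i t^(d-i)] relate neighbours only: [x] divides
    all monomials but the first, so it divides the first coefficient, and what
    remains is the same problem in degree [d - 1] after division by [x]. *)
Lemma syzygies_xt d (c : nat -> R) :
  \sum_(i < d.+1) c i * (x ^+ i * t ^+ (d - i)) = 0 ->
  exists2 f : nat -> R, (forall i, (d <= i)%N -> f i = 0) &
    forall i, (i <= d)%N -> c i = t * shift1 f i - x * f i.
Proof.
elim: d c => [|d IH] c.
  rewrite big_ord_recl big_ord0 !mulr1 addr0 => c0.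
  exists (fun=> 0) => // -[|//] _; rewrite c0 /=; ring.
rewrite big_ord_recl expr0 mul1r subn0.
have -> : \sum_(i < d.+1) c (lift ord0 i) * (x ^+ lift ord0 i * t ^+ (d.+1 - lift ord0 i))
   = x * \sum_(i < d.+1) c i.+1 * (x ^+ i * t ^+ (d - i)).
  by rewrite mulr_sumr; apply: eq_bigr => i _; rewrite /= /bump /= add1n exprS subSS; ring.
set S := \sum_(i < _) _ => E.
have {E} : x ^+ 1 * S = t ^+ d.+1 * (- c 0%N).
  by apply/eqP; rewrite -subr_eq0 -[X in _ == X]E expr1 /=; apply/eqP; ring.
case/koszulXn => // g [SE c0E].
have [] := IH (fun i => if i == 0%N then c 1%N - t * g else c i.+1).
  transitivity (S - t ^+ d.+1 * g); last by rewrite SE subrr.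
  rewrite /S [in RHS]big_ord_recl big_ord_recl /= exprS subn0; ring.
move=> f f0 fE; exists (fun i => if i is j.+1 then f j else g).
  by case=> // i; apply: f0.
case=> [|[|i]] id /=; first by rewrite -[LHS]opprK c0E expr1; ring.
  by have /= := fE 0%N id; move/(canRL (subrK _)) => ->; ring.
by have /= := fE i.+1 id.
Qed.

(** The factor [e] lies in [(x, t)^(d-1)] and
    [q x^j t^(d-1-j) = z x^(j+1) t^(d-1-j) - y x^j t^(d-j)], so the right-hand side
    is itself accounted for by the syzygies with coefficients [y] and [z]. *)
Lemma syzygies_qform d (c : nat -> R) e : (0 < d)%N ->
  \sum_(i < d.+1) c i * (x ^+ i * t ^+ (d - i)) = qform K * e ->
  exists f h : nat -> R, [/\ forall i, (d <= i)%N -> f i = 0,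
    forall i, (d <= i)%N -> h i = 0 & forall i, (i <= d)%N -> c i = relmap f h i].
Proof.
case: d => // d _ E.
have xtP i n : xtpow (i + n) (x ^+ i * t ^+ n).
  by move=> m; rewrite !mpolyXn -mpolyXD msuppX inE => /eqP ->;
    rewrite /xtdeg !mnmDE !mulmnE !mnm1E /=; lia.
have [|h0 hE] := @xtpow_span K d e.
  apply: xtpow_qform_div; rewrite -E.
  apply: (big_ind (xtpow d.+1)) => [m|p q|i _]; rewrite ?msupp0 //; first exact: xtpowD.
  move=> m /msuppM_le /allpairsP [[m1 m2] /= [_ h2 ->]].
  by have := xtP _ _ _ h2; rewrite xtdegD subnKC -ltnS //; lia.
pose h i := if (i <= d)%N then h0 i else 0.
have := @syzygies_xt d.+1 (fun i => c i - (z * shift1 h i - y * h i)).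
case=> [|f f0 fE]; last first.
  exists f, h; split=> // i id; first by rewrite /h leqNgt id.
  by have := fE i id; rewrite /relmap => <-; rewrite subrK.
under eq_bigr do rewrite mulrBl; rewrite sumrB E.
have := @sum_relmap d.+1 (fun=> 0) h (fun i => x ^+ i * t ^+ (d.+1 - i)).
rewrite /= /h ltnn => /(_ erefl erefl) => S.
apply/eqP; rewrite subr_eq0 hE mulr_sumr; apply/eqP.
transitivity (\sum_(i < d.+2) relmap (fun=> 0) h i * (x ^+ i * t ^+ (d.+1 - i))).
  rewrite S; apply: eq_bigr => i _.
  have id : (i <= d)%N by rewrite -ltnS.
  by rewrite id subSS (subSn id) !exprS /qform; ring.
apply: eq_bigr => i _; rewrite /relmap; congr (_ * _); case: (nat_of_ord i) => [|j]; rewrite /h /=; ring.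
Qed.

(** Consecutive pairs of a kernel element of [beta] satisfy
    [z p_k + y q_k = t p_(k+1) + x q_(k+1)].  If this value is in
    [(x, t)^n + (q)], then up to [(x, t)^n] the pair [(p_k, q_k)]
    is a combination of [(x, - t)] and [(y, - z)], for which [t p_k + x q_k] is 0 or
    a multiple of [q]: one power of [(x, t)] is gained. *)
Lemma xtpow_shift n p q w h : xtpow n w -> z * p + y * q = w + qform K * h ->
  exists w' h', xtpow n.+1 w' /\ t * p + x * q = w' + qform K * h'.
Proof.
move=> hw E.
have [|c [hc1 hc2]] := @koszul_mod_xtpow K n (p - x * h) (q + t * h).
  have -> : z * (p - x * h) + y * (q + t * h) = z * p + y * q - qform K * h.
    by rewrite /qform; ring.
  by rewrite E addrK.
exists (t * (p - x * h - y * c) + x * (q + t * h + z * c)), (- c); split.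
  by apply: xtpowD; apply: xtpow_var.
by rewrite /qform; ring.
Qed.

(** Going down from the last pair, each of the [d] steps gains a power. *)
Lemma beta_head d p q : (0 < d)%N -> (forall k, (k < d.-1)%N -> beta p q k = 0) ->
  exists w h, xtpow d w /\ t * p 0%N + x * q 0%N = w + qform K * h.
Proof.
move=> d0 pq.
have H n : (n < d)%N -> exists w h, xtpow n.+1 w /\
   t * p (d.-1 - n)%N + x * q (d.-1 - n)%N = w + qform K * h.
  elim: n => [|n IH] nd.
    apply: (@xtpow_shift 0 _ _ (z * p (d.-1 - 0)%N + y * q (d.-1 - 0)%N) 0) => //.
    by rewrite mulr0 addr0.
  have [|w [h [hw E]]] := IH; first exact: ltnW.
  apply: (@xtpow_shift n.+1 _ _ w h) => //; rewrite -E.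
  have := pq (d.-1 - n.+1)%N; have -> : ((d.-1 - n.+1).+1 = d.-1 - n)%N by lia.
  rewrite /beta; have -> : ((d.-1 - n.+1).+1 = d.-1 - n)%N by lia.
  move=> B; apply/eqP; rewrite -subr_eq0; apply/eqP; rewrite -[RHS]B; last by lia.
  ring.
by have := H d.-1; rewrite prednK // subnn; apply.
Qed.

(** After subtraction of lifts of the forms [x^i t^(d-i)], the head of the element
    is a multiple of [q], as for a Koszul syzygy; its coefficients [e_k] are then
    found one after the other, since each new pair satisfies a relation
    [t p + x q = 0] once [e_k] is known. *)
Lemma beta_exact d p q : (0 < d)%N -> (forall k, (k < d.-1)%N -> beta p q k = 0) ->
  exists c e, forall k, (k < d)%N ->
    p k = gammap d c k + alphap e k /\ q k = gammaq d c k + alphaq e k.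
Proof.
move=> d0 pq; have [w [h [hw E]]] := beta_head d0 pq.
have [c cE] := xtpow_span hw; exists c.
pose p' k := p k - gammap d c k; pose q' k := q k - gammaq d c k.
suff [e eE] : exists e, forall k, (k < d)%N -> p' k = alphap e k /\ q' k = alphaq e k.
  by exists e => k /eE [<- <-]; rewrite /p' /q'; split; rewrite addrCA subrr addr0.
have pq' k : (k < d.-1)%N -> beta p' q' k = 0.
  move=> kd; transitivity (beta p q k - beta (gammap d c) (gammaq d c) k).
    by rewrite /beta /p' /q'; ring.
  by rewrite pq // beta_gamma // subr0.
have E' : t * p' 0%N + x * q' 0%N = qform K * h.
  transitivity (t * p 0%N + x * q 0%N - (t * gammap d c 0 + x * gammaq d c 0)).
    by rewrite /p' /q'; ring.
  by rewrite E gamma_head // -cE addrAC subrr add0r.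
have H n : (n <= d)%N -> exists e : nat -> R, e 0%N = - h /\
    forall k, (k < n)%N -> p' k = alphap e k /\ q' k = alphaq e k.
  elim: n => [|n IH] nd; first by exists (fun=> - h).
  have [|e [e0 eE]] := IH; first exact: ltnW.
  have B : t * p' n + x * q' n = - qform K * e n.
    case: n nd {IH} eE => [|n] nd eE; first by rewrite E' e0; ring.
    have [pE qE] := eE n (ltnSn n).
    have := pq' n; rewrite /beta pE qE => B.
    apply/eqP; rewrite -subr_eq0 -oppr_eq0; apply/eqP; rewrite -[RHS]B; last by lia.
    by rewrite /alphap /alphaq /qform; ring.
  have [||a [pE qE]] := @koszulX K 3%:R 0 (p' n - y * e n) (q' n + z * e n) => //.
    transitivity (t * p' n + x * q' n + qform K * e n); last by rewrite B; ring.
    by rewrite /qform; ring.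
  exists (fun k => if k == n.+1 then a else e k); split=> // k kn.
  rewrite /alphap /alphaq eqSS (_ : (k == n.+1) = false); last by lia.
  case: eqP => [->|kn']; last by apply: eE; lia.
  split; first by move/(canRL (subrK _)): pE => ->; ring.
  by move/(canRL (addrK _)): qE => ->; ring.
by have [e [_ eE]] := H d (leqnn d); exists e.
Qed.

(** The head of the vanishing combination is a relation [\sum c_i x^i t^(d-i) = q e_0],
    so [c] comes from [relmap]; the value of [e] is then forced by the injectivity
    of [alpha]. *)
Lemma gamma_exact d c e : (0 < d)%N ->
  (forall k, (k < d)%N -> gammap d c k + alphap e k = 0 /\
                          gammaq d c k + alphaq e k = 0) ->
  exists f h : nat -> R, [/\ forall i, (d <= i)%N -> f i = 0,
    forall i, (d <= i)%N -> h i = 0 &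
    forall i, (i <= d)%N -> c i = relmap f h i /\ e i = - relcorr d f h i].
Proof.
move=> d0 E.
have [|f [h [f0 h0 cE]]] := @syzygies_qform d c (e 0%N) d0.
  rewrite -gamma_head //; have [/eqP + /eqP] := E 0%N d0.
  rewrite !addr_eq0 => /eqP -> /eqP ->; rewrite /alphap /alphaq /qform; ring.
exists f, h; split=> // i id; split; first exact: cE.
apply/eqP; rewrite -addr_eq0; apply/eqP.
apply: (@alpha_inj d (fun i => e i + relcorr d f h i)) => // k kd.
have [Ep Eq] := E k kd; have [Rp Rq] := gamma_relmap (f0 _ (leqnn d)) (h0 _ (leqnn d)) kd.
have cP (G : nat -> R) : \sum_(i < d.+1) c i * G i = \sum_(i < d.+1) relmap f h i * G i.
  by apply: eq_bigr => j _; rewrite cE // -ltnS.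
rewrite /gammap (cP (fun i => kergen_p d i k)) -/(gammap d (relmap f h) k) Rp in Ep.
rewrite /gammaq (cP (fun i => kergen_q d i k)) -/(gammaq d (relmap f h) k) Rq in Eq.
by split; [rewrite -[RHS]Ep /alphap | rewrite -[RHS]Eq /alphaq]; ring.
Qed.

(** With [epsh], the last differential: [e_j] is the coefficient of the Koszul
    relation [z r_(j+1) - y r_j = t s_(j+1) - x s_j] between
    [r_j = t g_(j+1) - x g_j] and [s_j = z g_(j+1) - y g_j]. *)
Definition epsf (e : nat -> R) i : R := z * shift1 e i - y * e i.
Definition epsh (e : nat -> R) i : R := x * e i - t * shift1 e i.

Lemma relmap_eps e i : relmap (epsf e) (epsh e) i = 0.
Proof. by rewrite /relmap /epsf /epsh; case: i => [|i] /=; ring. Qed.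

(** The equations are solved from [i = 0] upwards by the regularity of [x, y]; the
    last one reads [q e_(d-1) = 0], which cuts the solution at length [d - 1]. *)
Lemma relmap_exact d f h : (0 < d)%N -> (forall i, (d <= i)%N -> f i = 0) ->
  (forall i, (d <= i)%N -> h i = 0) -> (forall i, (i <= d)%N -> relmap f h i = 0) ->
  exists2 e, forall i, (d.-1 <= i)%N -> e i = 0 &
    forall i, (i < d)%N -> f i = epsf e i /\ h i = epsh e i.
Proof.
move=> d0 f0 h0 E.
have H n : (n <= d)%N -> exists e,
    forall k, (k < n)%N -> f k = epsf e k /\ h k = epsh e k.
  elim: n => [|n IH] nd; first by exists (fun=> 0).
  have [|e eE] := IH; first exact: ltnW.
  have [||a [fE hE]] := @koszulX K 0 1 (f n - z * shift1 e n) (h n + t * shift1 e n) => //.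
    rewrite -[RHS]oppr0 -(E n (ltnW nd)) /relmap.
    case: n nd {IH} eE => [|n] nd eE /=; first by ring.
    by have [-> ->] := eE n (ltnSn n); rewrite /epsf /epsh; ring.
  exists (fun k => if k == n then a else e k) => k kn.
  have preE : shift1 (fun k => if k == n then a else e k) k = shift1 e k.
    by case: k kn => //= k kn; rewrite (_ : (k == n) = false) //; lia.
  rewrite /epsf /epsh preE; case: eqP => [->|kn']; last by apply: eE; lia.
  split; first by move/(canRL (subrK _)): fE => ->; ring.
  by move/(canRL (addrK _)): hE => ->; ring.
have [e eE] := H d (leqnn d).
(* read off the equation of index d, where the lower neighbour of e_(d-1) cancels *)
have e0 : e d.-1 = 0.
  have dd : (d.-1 < d)%N by rewrite prednK.
  have [fE hE] := eE _ dd.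
  apply: (mulfI (@qform_neq0 K)); rewrite mulr0 -(E d (leqnn d)) /relmap f0 // h0 //.
  by rewrite -(prednK d0) /= fE hE /epsf /epsh /qform; ring.
exists (fun i => if (i < d.-1)%N then e i else 0) => i id.
  by rewrite ltnNge id.
have [-> ->] := eE i id; rewrite /epsf /epsh.
have -> : shift1 (fun i => if (i < d.-1)%N then e i else 0) i = shift1 e i.
  by case: i id => //= i id; rewrite (_ : (i < d.-1)%N) //; lia.
case: ltnP => // di; have -> : i = d.-1 by lia.
by rewrite e0.
Qed.

Lemma eps_inj d e : (forall i, (i < d)%N -> epsf e i = 0) ->
  forall i, (i < d)%N -> e i = 0.
Proof.
move=> h i; elim: i => [|i IH] id; apply: (mulfI (var_neq0 K 1)); rewrite mulr0.
  by have := h _ id; rewrite /epsf /= mulr0 sub0r => /eqP; rewrite oppr_eq0 => /eqP.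
have := h _ id; rewrite /epsf /= IH; last exact: ltnW.
by rewrite mulr0 sub0r => /eqP; rewrite oppr_eq0 => /eqP.
Qed.

End Strands.

(** * Ideals and homogeneous polynomials *)

Section IdealFacts.
Variable K : fieldType.
Local Notation R := (coordring K).
Implicit Types (J : ideal K) (p q : R).

Lemma ideal_opp J p : J p -> J (- p).
Proof. by rewrite -mulN1r; apply: idealM. Qed.

Lemma ideal_sub J p q : J p -> J q -> J (p - q).
Proof. by move=> hp /ideal_opp; apply: idealD. Qed.

Lemma ideal_mulr J p q : J p -> J (p * q).
Proof. by rewrite mulrC; apply: idealM. Qed.

Lemma ideal_sum J (I : Type) (r : seq I) (P : pred I) (F : I -> R) :
  (forall i, P i -> J (F i)) -> J (\sum_(i <- r | P i) F i).
Proof. by move=> h; apply: (big_ind J) => //; [apply: ideal0|apply: idealD]. Qed.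

Lemma irrelevant_var (i : 'I_4) : irrelevant K 'X_i.
Proof.
exists [:: (1, 'X_i)]; split; last by rewrite big_seq1 mul1r.
by move=> ?; rewrite inE => /eqP -> /=; exists i.
Qed.

Lemma irrelevant_ihomog k p : 0 < k -> ihomog k p -> irrelevant K p.
Proof.
move=> k0 hp; rewrite [p]mpolyE big_seq; apply: ideal_sum => m /hp mk.
have [i mi] : exists i, (0 < m i)%N.
  apply/existsP; apply: contraTT k0 => /existsPn h.
  rewrite -mk mdegE big1 // => i _; by have := h i; rewrite lt0n negbK => /eqP.
rewrite -(@submK _ U_(i)%MM m) ?lep1mP -?lt0n // mpolyXD scalerAl.
by apply: idealM; apply: irrelevant_var.
Qed.

Lemma ihomog_eq k l p : ihomog k p -> k = l -> ihomog l p.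
Proof. by move=> + <-. Qed.

Lemma ihomogN k p : ihomog k p -> ihomog k (- p).
Proof. by rewrite -sub0r; apply: ihomogB; apply: ihomog0. Qed.

Lemma ihomogD k p q : ihomog k p -> ihomog k q -> ihomog k (p + q).
Proof. by move=> hp /ihomogN hq; rewrite -[q]opprK; apply: ihomogB. Qed.

Lemma ihomog_varM k p (i : 'I_4) : ihomog k p -> ihomog (k + 1) ('X_i * p).
Proof. by rewrite addrC; apply: ihomogM; apply: ihomog_var. Qed.

Lemma ihomog_varX (i : 'I_4) n : ihomog n%:Z ('X_i ^+ n : R).
Proof. by rewrite -[n%:Z]mulr1; apply: ihomogX; apply: ihomog_var. Qed.

Lemma ihomog_mon3 (i j k : 'I_4) a b c (n : nat) : (a + b + c = n)%N ->
  ihomog n%:Z ('X_i ^+ a * 'X_j ^+ b * 'X_k ^+ c : R).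
Proof.
by move=> <-; rewrite !PoszD; do 2?apply: ihomogM; apply: ihomog_varX.
Qed.

End IdealFacts.

(** * Degrees, minimality and linearity of the differentials *)

Section StrandDegrees.
Variable K : fieldType.
Local Notation R := (coordring K).
Implicit Types (p q c e f h : nat -> R) (d i k : nat) (a b : int).

Lemma beta_ihomog a p q k : (forall i, ihomog a (p i)) -> (forall i, ihomog a (q i)) ->
  ihomog (a + 1) (beta p q k).
Proof.
by move=> hp hq; apply: ihomogB; [apply: ihomogD; [apply: ihomogB|]|];
  apply: ihomog_varM.
Qed.

Lemma alphap_ihomog a e k : (forall i, ihomog a (e i)) -> ihomog (a + 1) (alphap e k).
Proof. by move=> he; apply: ihomogB; apply: ihomog_varM. Qed.

Lemma alphaq_ihomog a e k : (forall i, ihomog a (e i)) -> ihomog (a + 1) (alphaq e k).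
Proof. by move=> he; apply: ihomogB; apply: ihomog_varM. Qed.

Lemma kergen_p_ihomog d i k : ihomog d.-1%:Z (kergen_p K d i k).
Proof.
rewrite /kergen_p; case: ifP => h; last exact: ihomog0.
by apply: ihomog_mon3; lia.
Qed.

Lemma kergen_q_ihomog d i k : (i <= d)%N -> (k < d)%N -> ihomog d.-1%:Z (kergen_q K d i k).
Proof.
rewrite /kergen_q; case: ifP => h id kd; first exact: ihomog0.
by apply: ihomog_mon3; lia.
Qed.

Lemma corr_tx_ihomog d i k : (i < d)%N -> (k <= d)%N -> ihomog d.-1%:Z (corr_tx K d i k).
Proof.
rewrite /corr_tx; case: ifP => h id kd; first exact: ihomog0.
by apply: ihomog_mon3; lia.
Qed.

Lemma corr_zy_ihomog d i k : ihomog d.-1%:Z (corr_zy K d i k).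
Proof.
rewrite /corr_zy; case: ifP => h; last exact: ihomog0.
by apply: ihomogN; apply: ihomog_mon3; lia.
Qed.

Lemma gammap_ihomog a d c k : (forall i, ihomog a (c i)) ->
  ihomog (a + d.-1%:Z) (gammap d c k).
Proof.
by move=> hc; apply: ihomog_sum => i _; apply: ihomogM => //; apply: kergen_p_ihomog.
Qed.

Lemma gammaq_ihomog a d c k : (k < d)%N -> (forall i, ihomog a (c i)) ->
  ihomog (a + d.-1%:Z) (gammaq d c k).
Proof.
move=> kd hc; apply: ihomog_sum => i _; apply: ihomogM => //.
by apply: kergen_q_ihomog; rewrite -ltnS.
Qed.

Lemma shift1_ihomog a f i : (forall i, ihomog a (f i)) -> ihomog a (shift1 f i).
Proof. by move=> hf; case: i => [|i] //=; apply: ihomog0. Qed.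

Lemma relmap_ihomog a f h k : (forall i, ihomog a (f i)) -> (forall i, ihomog a (h i)) ->
  ihomog (a + 1) (relmap f h k).
Proof.
move=> hf hh; apply: ihomogD; apply: ihomogB; apply: ihomog_varM => //;
  exact: shift1_ihomog.
Qed.

Lemma relcorr_ihomog a d f h k : (k <= d)%N -> (forall i, ihomog a (f i)) ->
  (forall i, ihomog a (h i)) -> ihomog (a + d.-1%:Z) (relcorr d f h k).
Proof.
move=> kd hf hh; apply: ihomog_sum => i _; apply: ihomogD; apply: ihomogM => //.
  exact: corr_tx_ihomog.
exact: corr_zy_ihomog.
Qed.

Lemma epsf_ihomog a e k : (forall i, ihomog a (e i)) -> ihomog (a + 1) (epsf e k).
Proof. by move=> he; apply: ihomogB; apply: ihomog_varM => //; apply: shift1_ihomog. Qed.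

Lemma epsh_ihomog a e k : (forall i, ihomog a (e i)) -> ihomog (a + 1) (epsh e k).
Proof. by move=> he; apply: ihomogB; apply: ihomog_varM => //; apply: shift1_ihomog. Qed.

Lemma irr_varM (i : 'I_4) (p : R) : irrelevant K ('X_i * p).
Proof. by apply: ideal_mulr; apply: irrelevant_var. Qed.

Lemma beta_irr p q k : irrelevant K (beta p q k).
Proof. by apply: ideal_sub; [apply: idealD; [apply: ideal_sub|]|]; apply: irr_varM. Qed.

Lemma alpha_irr e k : irrelevant K (alphap e k) /\ irrelevant K (alphaq e k).
Proof. by split; apply: ideal_sub; apply: irr_varM. Qed.

Lemma gamma_irr d c k : (1 < d)%N -> (k < d)%N ->
  irrelevant K (gammap d c k) /\ irrelevant K (gammaq d c k).
Proof.
move=> d1 kd; have d0 : (0 : int) < d.-1%:Z by lia.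
split; apply: ideal_sum => i _; apply: idealM; apply: (irrelevant_ihomog d0).
  exact: kergen_p_ihomog.
by apply: kergen_q_ihomog; rewrite -ltnS.
Qed.

Lemma relmap_irr f h k : irrelevant K (relmap f h k).
Proof. by apply: idealD; apply: ideal_sub; apply: irr_varM. Qed.

Lemma relcorr_irr d f h k : (1 < d)%N -> (k <= d)%N -> irrelevant K (relcorr d f h k).
Proof.
move=> d1 kd; have d0 : (0 : int) < d.-1%:Z by lia.
apply: ideal_sum => i _; apply: idealD; apply: idealM; apply: (irrelevant_ihomog d0).
  exact: corr_tx_ihomog.
exact: corr_zy_ihomog.
Qed.

Lemma eps_irr e k : irrelevant K (epsf e k) /\ irrelevant K (epsh e k).
Proof. by split; apply: ideal_sub; apply: irr_varM. Qed.

Section Linear.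
Variables (r : R) (c1 c2 e1 e2 : nat -> R).
Let lin (u v : nat -> R) i := r * u i + v i.

Lemma beta_lin k : beta (lin c1 c2) (lin e1 e2) k = r * beta c1 e1 k + beta c2 e2 k.
Proof. by rewrite /beta /lin; ring. Qed.
Lemma alphap_lin k : alphap (lin c1 c2) k = r * alphap c1 k + alphap c2 k.
Proof. by rewrite /alphap /lin; ring. Qed.
Lemma alphaq_lin k : alphaq (lin c1 c2) k = r * alphaq c1 k + alphaq c2 k.
Proof. by rewrite /alphaq /lin; ring. Qed.
Lemma gammap_lin d k : gammap d (lin c1 c2) k = r * gammap d c1 k + gammap d c2 k.
Proof.
rewrite /gammap mulr_sumr -big_split; apply: eq_bigr => i _; rewrite /lin /=; ring.
Qed.
Lemma gammaq_lin d k : gammaq d (lin c1 c2) k = r * gammaq d c1 k + gammaq d c2 k.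
Proof.
rewrite /gammaq mulr_sumr -big_split; apply: eq_bigr => i _; rewrite /lin /=; ring.
Qed.
Lemma shift1_lin k : shift1 (lin c1 c2) k = r * shift1 c1 k + shift1 c2 k.
Proof. by case: k => //=; rewrite mulr0 addr0. Qed.
Lemma relmap_lin k : relmap (lin c1 c2) (lin e1 e2) k = r * relmap c1 e1 k + relmap c2 e2 k.
Proof. by rewrite /relmap !shift1_lin; case: k => [|k]; rewrite /lin /=; ring. Qed.
Lemma relcorr_lin d k :
  relcorr d (lin c1 c2) (lin e1 e2) k = r * relcorr d c1 e1 k + relcorr d c2 e2 k.
Proof.
rewrite /relcorr mulr_sumr -big_split; apply: eq_bigr => i _; rewrite /lin /=; ring.
Qed.
Lemma epsf_lin k : epsf (lin c1 c2) k = r * epsf c1 k + epsf c2 k.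
Proof. by rewrite /epsf !shift1_lin /lin; ring. Qed.
Lemma epsh_lin k : epsh (lin c1 c2) k = r * epsh c1 k + epsh c2 k.
Proof. by rewrite /epsh !shift1_lin /lin; ring. Qed.
End Linear.

End StrandDegrees.

(** * Graded maps between free modules from coefficient formulas *)

Section Columns.
Variable K : fieldType.
Local Notation R := (coordring K).

Definition cut (n : nat) (c : nat -> R) k : R := if (k < n)%N then c k else 0.
Definition glue (n : nat) (c e : nat -> R) k : R := if (k < n)%N then c k else e (k - n)%N.
(** Entries outside the vector are 0, so that the formulas of the differentials make
    sense at the boundary without bounded indices. *)
Definition entry m (v : 'cV[R]_m) k : R := if insub k is Some i then v i 0 else 0.
Definition lo n m (v : 'cV[R]_m) := cut n (entry v).
Definition hi n m (v : 'cV[R]_m) k : R := entry v (n + k)%N.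
Definition column m (c : nat -> R) : 'cV[R]_m := \col_(i < m) c i.

Lemma glue_lo n c e k : (k < n)%N -> glue n c e k = c k.
Proof. by rewrite /glue => ->. Qed.

Lemma glue_hi n c e k : glue n c e (n + k) = e k.
Proof. by rewrite /glue (_ : (n + k < n)%N = false) ?addKn //; lia. Qed.

Lemma entry_ord m (v : 'cV[R]_m) (i : 'I_m) : entry v i = v i 0.
Proof. by rewrite /entry valK. Qed.

Lemma entry_column m c k : entry (column m c) k = cut m c k.
Proof. by rewrite /entry /cut; case: insubP => [i -> <-|/negbTE ->]; rewrite ?mxE. Qed.

Lemma entry_out m (v : 'cV[R]_m) k : (m <= k)%N -> entry v k = 0.
Proof. by rewrite /entry; case: insubP => // i + _; rewrite ltnNge => /negbTE ->. Qed.

Lemma entry_lin m a (u v : 'cV[R]_m) k : entry (a *: u + v) k = a * entry u k + entry v k.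
Proof. by rewrite /entry; case: insubP => [i _ _|_]; rewrite ?mxE ?mulr0 ?addr0. Qed.

Lemma lo_lin n m a (u v : 'cV[R]_m) : lo n (a *: u + v) = fun k => a * lo n u k + lo n v k.
Proof.
by apply/funext => k; rewrite /lo /cut entry_lin; case: ifP; rewrite ?mulr0 ?addr0.
Qed.

Lemma hi_lin n m a (u v : 'cV[R]_m) : hi n (a *: u + v) = fun k => a * hi n u k + hi n v k.
Proof. by apply/funext => k; rewrite /hi entry_lin. Qed.

Lemma lo_column n m l c e : m = (n + l)%N -> lo n (column m (glue n c e)) = cut n c.
Proof.
move=> ->; apply/funext => k; rewrite /lo /cut entry_column /cut /glue.
by case: ltnP => // kn; rewrite ltn_addr.
Qed.

Lemma hi_column n m l c e : m = (n + l)%N -> hi n (column m (glue n c e)) = cut l e.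
Proof.
move=> ->; apply/funext => k; rewrite /hi entry_column /cut /glue ltn_add2l.
by rewrite (_ : (n + k < n)%N = false) ?addKn //; lia.
Qed.

Lemma columnP m n (v : 'cV[R]_m) (c : nat -> R) :
  (forall k, (k < n)%N -> (k < m)%N -> lo n v k = c k) ->
  (forall k, (n + k < m)%N -> hi n v k = c (n + k)%N) -> v = column m c.
Proof.
move=> h1 h2; apply/colP => i; rewrite mxE -entry_ord.
have [ln|ln] := ltnP i n; first by rewrite -h1 ?ltn_ord // /lo /cut ln.
by have := h2 (i - n)%N; rewrite /hi subnKC //; apply.
Qed.

Lemma cut_id n c : (forall k, (n <= k)%N -> c k = 0) -> cut n c = c.
Proof. by move=> h; apply/funext => k; rewrite /cut; case: ltnP => // /h ->. Qed.

Lemma lo_out n m (v : 'cV[R]_m) k : (n <= k)%N -> lo n v k = 0.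
Proof. by rewrite /lo /cut ltnNge => ->. Qed.

Lemma hi_out n m l (v : 'cV[R]_m) k : m = (n + l)%N -> (l <= k)%N -> hi n v k = 0.
Proof. by move=> mE lk; rewrite /hi entry_out // mE leq_add2l. Qed.

Lemma gammap_cut d c : gammap d (cut d.+1 c) = gammap d c.
Proof. by apply/funext => k; apply: eq_bigr => i _; rewrite /cut ltn_ord. Qed.
Lemma gammaq_cut d c : gammaq d (cut d.+1 c) = gammaq d c.
Proof. by apply/funext => k; apply: eq_bigr => i _; rewrite /cut ltn_ord. Qed.
Lemma alphap_cut d e k : (k < d)%N -> alphap (cut d.+1 e) k = alphap e k.
Proof. by move=> kd; rewrite /alphap /cut !ltnS kd ltnW. Qed.
Lemma alphaq_cut d e k : (k < d)%N -> alphaq (cut d.+1 e) k = alphaq e k.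
Proof. by move=> kd; rewrite /alphaq /cut !ltnS kd ltnW. Qed.

Section ColumnHom.
Variables (F G : gens) (phi : 'cV[R]_(grank F) -> nat -> R).
Hypothesis phi_lin : forall a u v k, phi (a *: u + v) k = a * phi u k + phi v k.
Hypothesis phi_deg : forall j u, gpiece (g := freemod K F) j u ->
  forall i : 'I_(grank G), ihomog (j - gdeg i) (phi u i).

Definition col_fun of (forall a u v k, phi (a *: u + v) k = a * phi u k + phi v k) :
  freemod K F -> freemod K G := fun v => column (grank G) (phi v).

Lemma col_fun_linear : linear (col_fun phi_lin).
Proof. by move=> a u v; apply/colP => i; rewrite !mxE phi_lin. Qed.
HB.instance Definition _ := GRing.isLinear.Build (coordring K)
  (freemod K F) (freemod K G) _ (col_fun phi_lin) col_fun_linear.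

Lemma col_fun_piece j u : gpiece j u -> gpiece j (col_fun phi_lin u).
Proof. by move=> hu i; rewrite mxE; apply: phi_deg. Qed.

Definition col_ghom : ghom (freemod K F) (freemod K G) := GHom col_fun_piece.

Lemma col_ghomE u : col_ghom u = column (grank G) (phi u).
Proof. by []. Qed.
End ColumnHom.

Lemma entry_ihomog F j a (u : freemod K F) : gpiece j u ->
  (forall i : 'I_(grank F), gdeg i = a) -> forall k, ihomog (j - a) (entry u k).
Proof.
move=> hu ha k; rewrite /entry; case: insubP => [i _ _|_]; last exact: ihomog0.
by rewrite -(ha i); apply: hu.
Qed.

Lemma cut_ihomog n c a : (forall k, ihomog a (c k)) -> forall k, ihomog a (cut n c k).
Proof. by move=> h k; rewrite /cut; case: ifP => // _; apply: ihomog0. Qed.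

Lemma gdeg_add n m a b (i : 'I_(n + m)) :
  gdeg (i : 'I_(grank (gens_add (twist n a) (twist m b)))) = if (i < n)%N then - a else - b.
Proof.
by rewrite /=; case: splitP.
Qed.

Lemma lo_hi_ihomog n m a b j (u : freemod K (gens_add (twist n a) (twist m b))) :
  gpiece j u -> (forall k, ihomog (j + a) (lo n u k)) /\ (forall k, ihomog (j + b) (hi n u k)).
Proof.
move=> hu; split=> k.
  rewrite /lo /cut /entry; case: ifP => kn; last exact: ihomog0.
  case: insubP => [i _ ik|_]; last exact: ihomog0.
  by have := hu i; rewrite gdeg_add ik kn opprK.
rewrite /hi /entry; case: insubP => [i _ ik|_]; last exact: ihomog0.
by have := hu i; rewrite gdeg_add ik ltnNge leq_addr opprK.
Qed.

End Columns.

(** * The differentials of the resolution *)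

Section Resolution.
Variables (K : fieldType) (d : nat) (hd : (1 < d)%N).
Local Notation R := (coordring K).
Let d0 : (0 < d)%N. Proof. exact: ltnW. Qed.

Let F0 := twist d.-1 0.
Let F1 := twist (2 * d) (-1).
Let F2 := gens_add (twist d.+1 (- d%:Z)) (twist d.+1 (- 2%:Z)).
Let F3 := twist (2 * d) (- d%:Z - 1).
Let F4 := twist d.-1 (- d%:Z - 2%:Z).

Let e2d : (2 * d = d + d)%N. Proof. by rewrite mul2n addnn. Qed.

Definition diff0_fun (v : freemod K F1) := beta (lo d v) (hi d v).
Lemma diff0_fun_lin a u v k : diff0_fun (a *: u + v) k = a * diff0_fun u k + diff0_fun v k.
Proof. by rewrite /diff0_fun lo_lin hi_lin beta_lin. Qed.
Lemma diff0_fun_deg j u : gpiece (g := freemod K F1) j u ->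
  forall i : 'I_(grank F0), ihomog (j - gdeg i) (diff0_fun u i).
Proof.
move=> hu i; have h := entry_ihomog hu (fun=> erefl).
have := @beta_ihomog K _ (lo d u) (hi d u) i (@cut_ihomog K d _ _ h) (fun k => h _).
by move/ihomog_eq; apply; rewrite /=; lia.
Qed.

Definition diff1_fun (v : freemod K F2) :=
  let c := lo d.+1 v in let e := hi d.+1 v in
  glue d (fun k => gammap d c k + alphap e k) (fun k => gammaq d c k + alphaq e k).
Lemma diff1_fun_lin a u v k : diff1_fun (a *: u + v) k = a * diff1_fun u k + diff1_fun v k.
Proof.
rewrite /diff1_fun lo_lin hi_lin /glue; case: ifP => _.
  by rewrite gammap_lin alphap_lin; ring.
by rewrite gammaq_lin alphaq_lin; ring.
Qed.
Lemma diff1_fun_deg j u : gpiece (g := freemod K F2) j u ->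
  forall i : 'I_(grank F1), ihomog (j - gdeg i) (diff1_fun u i).
Proof.
move=> hu i; have [hc he] := lo_hi_ihomog hu.
rewrite /diff1_fun /glue; case: ifP => id; apply: ihomogD.
- by apply: (@ihomog_eq K _ _ _ (@gammap_ihomog K _ d _ i hc)); rewrite /=; lia.
- by apply: (@ihomog_eq K _ _ _ (@alphap_ihomog K _ _ i he)); rewrite /=; lia.
- have kd : (i - d < d)%N by have := ltn_ord i; rewrite /=; lia.
  by apply: (@ihomog_eq K _ _ _ (@gammaq_ihomog K _ d _ _ kd hc)); rewrite /=; lia.
- by apply: (@ihomog_eq K _ _ _ (@alphaq_ihomog K _ _ (i - d)%N he)); rewrite /=; lia.
Qed.

Definition diff2_fun (v : freemod K F3) :=
  glue d.+1 (relmap (lo d v) (hi d v)) (fun k => - relcorr d (lo d v) (hi d v) k).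
Lemma diff2_fun_lin a u v k : diff2_fun (a *: u + v) k = a * diff2_fun u k + diff2_fun v k.
Proof.
rewrite /diff2_fun lo_lin hi_lin /glue; case: ifP => _; first by rewrite relmap_lin.
by rewrite relcorr_lin; ring.
Qed.
Lemma diff2_fun_deg j u : gpiece (g := freemod K F3) j u ->
  forall i : 'I_(grank F2), ihomog (j - gdeg i) (diff2_fun u i).
Proof.
move=> hu i; have h := entry_ihomog hu (fun=> erefl).
have hf := @cut_ihomog K d _ _ h; have hh k := h (d + k)%N.
rewrite gdeg_add /diff2_fun /glue; case: ifP => id.
  by apply: (@ihomog_eq K _ _ _ (@relmap_ihomog K _ _ _ i hf hh)); rewrite /=; lia.
have kd : (i - d.+1 <= d)%N by have := ltn_ord i; rewrite /=; lia.
apply: ihomogN; by apply: (@ihomog_eq K _ _ _ (@relcorr_ihomog K _ d _ _ _ kd hf hh)); rewrite /=; lia.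
Qed.

Definition diff3_fun (v : freemod K F4) := glue d (epsf (entry v)) (epsh (entry v)).
Lemma diff3_fun_lin a u v k : diff3_fun (a *: u + v) k = a * diff3_fun u k + diff3_fun v k.
Proof.
have -> : diff3_fun (a *: u + v) k = glue d (epsf (fun i => a * entry u i + entry v i))
    (epsh (fun i => a * entry u i + entry v i)) k.
  by rewrite /diff3_fun; congr (glue _ (epsf _) (epsh _) _); apply/funext => i; apply: entry_lin.
by rewrite /diff3_fun /glue; case: ifP => _; rewrite ?epsf_lin ?epsh_lin.
Qed.
Lemma diff3_fun_deg j u : gpiece (g := freemod K F4) j u ->
  forall i : 'I_(grank F3), ihomog (j - gdeg i) (diff3_fun u i).
Proof.
move=> hu i; have h := entry_ihomog hu (fun=> erefl).
rewrite /diff3_fun /glue; case: ifP => _.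
  by apply: (@ihomog_eq K _ _ _ (@epsf_ihomog K _ _ i h)); rewrite /=; lia.
by apply: (@ihomog_eq K _ _ _ (@epsh_ihomog K _ _ (i - d)%N h)); rewrite /=; lia.
Qed.

Definition diff0 := col_ghom diff0_fun_lin diff0_fun_deg.
Definition diff1 := col_ghom diff1_fun_lin diff1_fun_deg.
Definition diff2 := col_ghom diff2_fun_lin diff2_fun_deg.
Definition diff3 := col_ghom diff3_fun_lin diff3_fun_deg.

Section Zero.
Variables F G : gens.
Definition zero_fun (v : freemod K F) (k : nat) : R := 0.
Lemma zero_fun_lin a u v k : zero_fun (a *: u + v) k = a * zero_fun u k + zero_fun v k.
Proof. by rewrite /zero_fun mulr0 addr0. Qed.
Lemma zero_fun_deg j u : gpiece (g := freemod K F) j u ->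
  forall i : 'I_(grank G), ihomog (j - gdeg i) (zero_fun u i).
Proof. by move=> _ i; apply: ihomog0. Qed.
Definition zero_ghom : ghom (freemod K F) (freemod K G) := col_ghom zero_fun_lin zero_fun_deg.
End Zero.

Lemma column_eq0 m (c : nat -> R) : column m c = 0 <-> forall k, (k < m)%N -> c k = 0.
Proof.
split=> [h k km|h]; last by apply/colP => i; rewrite !mxE h.
by have := congr1 (fun v : 'cV_m => v (Ordinal km) 0) h; rewrite !mxE.
Qed.

Lemma diff0_exact : exact_at diff1 diff0.
Proof.
move=> v; rewrite col_ghomE column_eq0; split.
  move=> h; have [c [e E]] := beta_exact d0 h.
  exists (column (grank F2) (glue d.+1 c e)).
  rewrite col_ghomE /diff1_fun (@lo_column _ _ _ d.+1) // (@hi_column _ _ _ d.+1) //.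
  apply: (@columnP _ _ d) => k => [kd _|kd]; rewrite /glue gammap_cut gammaq_cut.
    by rewrite kd alphap_cut //; have [-> _] := E k kd.
  have {}kd : (k < d)%N by move: kd; rewrite /=; lia.
  rewrite ltnNge leq_addr addKn alphaq_cut //; have [_ ->] := E k kd.
  done.
case=> u -> k kd; rewrite /diff0_fun col_ghomE /diff1_fun.
rewrite (@lo_column _ _ _ d) // (@hi_column _ _ _ d) //.
set c := lo _ _; set e := hi _ _.
transitivity (beta (gammap d c) (gammaq d c) k + beta (alphap e) (alphaq e) k).
  have kd' : (k < d)%N by move: kd; rewrite /=; lia.
  have kd'' : (k.+1 < d)%N by move: kd; rewrite /=; lia.
  by rewrite /beta /cut kd' kd''; ring.
by rewrite beta_gamma // beta_alpha addr0.
Qed.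

Lemma diff1_exact : exact_at diff2 diff1.
Proof.
move=> v; rewrite col_ghomE column_eq0; split.
  move=> h; have [|f [g [f0 g0 E]]] := @gamma_exact K d (lo d.+1 v) (hi d.+1 v) d0.
    move=> k kd; split.
      by have := h k; rewrite /diff1_fun glue_lo // => -> //=; lia.
    by have := h (d + k)%N; rewrite /diff1_fun glue_hi => -> //=; lia.
  exists (column (grank F3) (glue d f g)).
  rewrite col_ghomE /diff2_fun (@lo_column _ _ _ d) // (@hi_column _ _ _ d) //.
  rewrite (cut_id f0) (cut_id g0).
  apply: (@columnP _ _ d.+1) => k => [kd _|kd]; rewrite /glue.
    by rewrite kd; have [-> _] := E k kd.
  rewrite ltnNge leq_addr addKn; have kd' : (k <= d)%N by move: kd; rewrite /=; lia.
  by have [_ ->] := E k kd'.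
case=> u -> k kd; rewrite /diff1_fun col_ghomE /diff2_fun.
rewrite (@lo_column _ _ _ d.+1) // (@hi_column _ _ _ d.+1) //.
rewrite gammap_cut gammaq_cut; set f := lo _ _; set g := hi _ _.
have f0 : f d = 0 by apply: lo_out.
have g0 : g d = 0 by apply: (@hi_out _ _ _ d).
rewrite /glue; case: ltnP => kd'.
  rewrite alphap_cut //; have [-> _] := gamma_relmap f0 g0 kd'.
  by rewrite /alphap; ring.
have {}kd : (k - d < d)%N by move: kd; rewrite /=; lia.
rewrite alphaq_cut //; have [_ ->] := gamma_relmap f0 g0 kd.
by rewrite /alphaq; ring.
Qed.

Lemma diff2_exact : exact_at diff3 diff2.
Proof.
move=> v; rewrite col_ghomE column_eq0; split.
  move=> h; have [||||e e0 E] := @relmap_exact K d (lo d v) (hi d v) => //.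
  - by move=> i; apply: lo_out.
  - by move=> i; apply: hi_out.
  - move=> i id; have := h i; rewrite /diff2_fun glue_lo //; apply=> /=; lia.
  exists (column (grank F4) e); rewrite col_ghomE /diff3_fun.
  rewrite (_ : entry _ = e); last first.
    by apply/funext => k; rewrite entry_column -[RHS](congr1 (fun c => c k) (cut_id e0)).
  apply: (@columnP _ _ d) => k => [kd _|kd]; rewrite /glue.
    by rewrite kd; have [-> _] := E k kd.
  rewrite ltnNge leq_addr addKn; have kd' : (k < d)%N by move: kd; rewrite /=; lia.
  by have [_ ->] := E k kd'.
case=> u -> k kd; rewrite /diff2_fun col_ghomE /diff3_fun.
rewrite (@lo_column _ _ _ d) // (@hi_column _ _ _ d) //.
set e := entry u; have e0 i : (d.-1 <= i)%N -> e i = 0 by apply: entry_out.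
have epsd i : (d <= i)%N -> epsf e i = 0 /\ epsh e i = 0.
  move=> id; rewrite /epsf /epsh e0; last by lia.
  by case: i id => [|i] id /=; rewrite ?e0 ?mulr0 ?subr0 //; lia.
rewrite !cut_id => [|i /epsd[]|i /epsd[]] //.
rewrite /glue; case: ltnP => kd'; first exact: relmap_eps.
have {}kd : (k - d.+1 <= d)%N by move: kd; rewrite /=; lia.
have [|fd gd] := epsd d; first exact: leqnn.
apply/eqP; rewrite oppr_eq0; apply/eqP; apply: (alpha_inj d0 _ kd) => i id.
have [<- <-] := gamma_relmap fd gd id; rewrite /gammap /gammaq.
by split; rewrite big1 // => l _; rewrite relmap_eps mul0r.
Qed.

Lemma diff3_inj (v : freemod K F4) : diff3 v = 0 -> v = 0.
Proof.
rewrite col_ghomE column_eq0 => h; apply/colP => i; rewrite mxE -entry_ord.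
apply: (@eps_inj K d.-1); last exact: ltn_ord.
move=> k kd; have := h k; rewrite /diff3_fun /glue (_ : (k < d)%N); last by lia.
by apply=> /=; lia.
Qed.

Definition resgens (i : nat) : gens :=
  match i with 0%N => F0 | 1%N => F1 | 2%N => F2 | 3%N => F3 | 4%N => F4 | _ => twist 0 0 end.

Definition resmap (i : nat) : ghom (freemod K (resgens i.+1)) (freemod K (resgens i)) :=
  match i with 0%N => diff0 | 1%N => diff1 | 2%N => diff2 | 3%N => diff3 | _ => zero_ghom _ _ end.

Lemma resmap_min i (u : freemod K (resgens i.+1)) r :
  irrelevant K ((resmap i u : 'cV_ _) r 0).
Proof.
case: i u r => [|[|[|[|i]]]] u r; rewrite /resmap col_ghomE mxE.
- exact: beta_irr.
- rewrite /diff1_fun /glue; case: ltnP => rd; apply: idealD.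
  + by case: (gamma_irr (lo d.+1 u) hd rd).
  + by case: (alpha_irr (hi d.+1 u) r).
  + have {}rd : (r - d < d)%N by have := ltn_ord r; rewrite /=; lia.
    by case: (gamma_irr (lo d.+1 u) hd rd).
  + by case: (alpha_irr (hi d.+1 u) (r - d)).
- rewrite /diff2_fun /glue; case: ltnP => rd; first exact: relmap_irr.
  by apply/ideal_opp/relcorr_irr => //; have := ltn_ord r; rewrite /=; lia.
- by rewrite /diff3_fun /glue; case: ifP => _; case: (eps_irr (entry u) r) (eps_irr (entry u) (r - d)) => ? ? [].
- exact: ideal0.
Qed.

Lemma resolution (M : gmod K) (e : ghom (freemod K F0) M) :
  (forall v : M, exists u, v = e u) -> exact_at diff0 e -> has_min_free_res M resgens.
Proof.
move=> es ek; exists e, resmap; split=> //; last exact: resmap_min.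
move=> [|[|[|[|i]]]].
- exact: diff0_exact.
- exact: diff1_exact.
- exact: diff2_exact.
- move=> v; split=> [/diff3_inj ->|[u ->]]; first by exists 0; rewrite raddf0.
  by rewrite /= (_ : zero_ghom _ _ u = 0) ?raddf0 //; apply/colP => k; rewrite !mxE.
- move=> v; split=> [_|_]; last by apply/colP => k; rewrite !mxE.
  by exists 0; apply/colP => -[k kl]; case: (notF kl).
Qed.

End Resolution.

(** * The parametrisation y = x w, z = t w of the quadric *)

Section Parametrisation.
Variable K : fieldType.
Local Notation R := (coordring K).

Local Notation x := ('X_0 : R).
Local Notation y := ('X_1 : R).
Local Notation z := ('X_2 : R).
Local Notation t := ('X_3 : R).

(** Properties stable under the ring operations need only be checked on constants and
    variables; this is how ring maps out of [R] are compared below. *)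
Lemma mpoly_ring_ind (P : R -> Prop) :
  (forall c, P c%:MP) -> (forall i : 'I_4, P 'X_i) ->
  (forall a b, P a -> P b -> P (a + b)) -> (forall a b, P a -> P b -> P (a * b)) ->
  forall a, P a.
Proof.
move=> PC PX PD PM a; rewrite [a]mpolyE; apply: (big_ind P); [exact: PC|exact: PD|].
move=> m _; rewrite -mul_mpolyC; apply: (PM) => //; rewrite mpolyXE_id.
apply: (big_ind P); [exact: PC|exact: PM|].
by move=> i _; elim: (m i) => [|n IH]; [apply: PC | rewrite exprS; apply: PM].
Qed.

Definition phivar (i : 'I_4) : {poly R} :=
  [:: x%:P; x *: 'X; t *: 'X; t%:P]`_i.

Definition phi : {rmorphism R -> {poly R}} := mmap (polyC \o @mpolyC 4 K) phivar.

Lemma phiC c : phi c%:MP = (c%:MP)%:P.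
Proof. exact: mmapC. Qed.

Lemma phiX i : phi 'X_i = phivar i.
Proof. by rewrite /phi /= mmapX mmap1U. Qed.

Lemma phi_qform : phi (qform K) = 0.
Proof.
rewrite /qform rmorphB !rmorphM /= !phiX /phivar /= -!mul_polyC; ring.
Qed.

Lemma coefM_ihomog k l (g h : {poly R}) : (forall i, ihomog k g`_i) ->
  (forall i, ihomog l h`_i) -> forall i, ihomog (k + l) (g * h)`_i.
Proof.
by move=> hg hh i; rewrite coefM; apply: ihomog_sum => j _; apply: ihomogM.
Qed.

Lemma coefX_ihomog n (g : {poly R}) : (forall i, ihomog 1 g`_i) ->
  forall i, ihomog n%:Z (g ^+ n)`_i.
Proof.
move=> hg; elim: n => [|n IH] i.
  rewrite coef1; case: eqP => _; last exact: ihomog0.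
  exact/(ihomogP 0)/dhomog1.
by rewrite exprS -add1n PoszD; apply: coefM_ihomog.
Qed.

Lemma phivar_ihomog i l : ihomog 1 (phivar i)`_l.
Proof.
have X (r : 'I_4) : ihomog 1 ('X_r : R) by apply: ihomog_var.
case: i => [[|[|[|[|]]]] hi] //; rewrite /phivar /= ?coefC ?coefZ ?coefX;
  case: eqP => _; rewrite ?mulr1 ?mulr0; by [apply: X | apply: ihomog0].
Qed.

(** With [w] in degree 0 the substitution preserves degrees. *)
Lemma phi_ihomog k a l : ihomog k a -> ihomog k (phi a)`_l.
Proof.
move=> ha; rewrite [a]mpolyE rmorph_sum coef_sum; apply: ihomog_sum => m /ha <-.
rewrite -mul_mpolyC rmorphM /= phiC coefCM -[(mdeg m)%:Z]add0r; apply: ihomogM.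
  by apply/(ihomogP 0)/dhomogP => m'; rewrite msuppC; case: ifP => // _; rewrite inE => /eqP ->; exact: mdeg0.
rewrite mpolyXE_id rmorph_prod /= mdegE.
elim: (index_enum _) l => [|i r IH] l.
  rewrite !big_nil coef1; case: eqP => _; last exact: ihomog0.
  exact/(ihomogP 0)/dhomog1.
rewrite !big_cons PoszD; apply: coefM_ihomog => // {}l.
by rewrite rmorphXn /= phiX; apply: coefX_ihomog => j; apply: phivar_ihomog.
Qed.

Definition vanish (n : nat) (h : {poly R}) : Prop := exists g, h = 'X^n * g.

Lemma vanishP n (h : {poly R}) : (forall k, (k < n)%N -> h`_k = 0) -> vanish n h.
Proof.
move=> h0; exists (drop_poly n h); rewrite -[LHS](poly_take_drop n) mulrC.
rewrite [take_poly n h](_ : _ = 0) ?add0r //; apply/polyP => i.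
by rewrite coef_take_poly coef0; case: ifP => // /h0.
Qed.

Lemma vanish_coef n (h : {poly R}) k : vanish n h -> (k < n)%N -> h`_k = 0.
Proof. by move=> [g ->] kn; rewrite coefXnM kn. Qed.

Lemma vanishD n g h : vanish n g -> vanish n h -> vanish n (g + h).
Proof. by move=> [g' ->] [h' ->]; exists (g' + h'); rewrite mulrDr. Qed.

Lemma vanishM n m g h : vanish n g -> vanish m h -> vanish (n + m) (g * h).
Proof. by move=> [g' ->] [h' ->]; exists (g' * h'); rewrite exprD; ring. Qed.

Lemma vanish_mull n g h : vanish n h -> vanish n (g * h).
Proof. by move=> [h' ->]; exists (g * h'); ring. Qed.

Lemma vanish0 h : vanish 0 h.
Proof. by exists h; rewrite expr0 mul1r. Qed.

Lemma vanish_zero n : vanish n 0.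
Proof. by exists 0; rewrite mulr0. Qed.

Lemma gen_set_ind (S : set R) (P : R -> Prop) : P 0 ->
  (forall a b, P a -> P b -> P (a + b)) -> (forall a b, S b -> P (a * b)) ->
  forall a, gen_set S a -> P a.
Proof.
move=> P0 PD PM a [s [hs ->]]; rewrite big_seq.
by apply: (big_ind P) => // b /hs; apply: PM.
Qed.

Lemma phi_idealJ d a : idealJ K d a -> vanish d (phi a).
Proof.
apply: (@gen_set_ind _ (fun a => vanish d (phi a))) => [|a1 a2|c' b']; rewrite ?rmorph0 ?rmorphD ?rmorphM /=.
- exact: vanish_zero.
- exact: vanishD.
case=> [->|]; first by rewrite -/(qform K) phi_qform mulr0; apply: vanish_zero.
move=> hb; apply: vanish_mull.
move: b' hb; apply: (@gen_set_ind _ (fun a => vanish d (phi a))) => [|a1 a2|e b]; rewrite ?rmorph0 ?rmorphD ?rmorphM /=.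
- exact: vanish_zero.
- exact: vanishD.
move=> [g [hg ->]]; apply: vanish_mull.
have yz (i : 'I_4) : (i == 1) || (i == 2%:R) -> vanish 1 (phi 'X_i).
  rewrite phiX => /orP[] /eqP ->; rewrite /phivar /= -mul_polyC.
    by exists x%:P; rewrite expr1; ring.
  by exists t%:P; rewrite expr1; ring.
rewrite rmorph_prod; suff: vanish (\sum_(i < d) 1) (\prod_(i < d) phi (g i)).
  by rewrite sum1_card card_ord.
elim/big_rec2: _ => [|i n h _ IH]; first exact: vanish0.
apply: vanishM IH; have := hg i; apply: (@gen_set_ind _ (fun a => vanish 1 (phi a))) => [|a1 a2|c2 b2]; rewrite ?rmorph0 ?rmorphD ?rmorphM /=.
- exact: vanish_zero.
- exact: vanishD.
move=> hb; apply: vanish_mull.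
by case: hb => ->; apply: yz; rewrite eqxx ?orbT.
Qed.

Lemma gen_set_mem (S : set R) a : S a -> gen_set S a.
Proof.
move=> Sa; exists [:: (1, a)]; split; last by rewrite big_seq1 mul1r.
by move=> b; rewrite inE => /eqP ->.
Qed.

Lemma idealJ_qform d : idealJ K d (qform K).
Proof. by apply: gen_set_mem; left. Qed.

Lemma idealJ_yz d (i : 'I_4) : (i == 1) || (i == 2%:R) -> idealJ K d ('X_i ^+ d).
Proof.
move=> hi; apply: gen_set_mem; right; apply: gen_set_mem.
exists (fun=> 'X_i); split; last by rewrite prodr_const card_ord.
by move=> _; apply: gen_set_mem; case/orP: hi => /eqP ->; [left|right].
Qed.

End Parametrisation.

(** * Localizations of an ideal and evaluation of w *)

Section Localization.
Variable K : fieldType.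
Local Notation R := (coordring K).
Implicit Types (J : ideal K) (a b f g : R) (u v w : ratfun K).

(** The embedding of [R] in its fraction field, with [ratfun K] as codomain so that
    the field operations are those of the Cech complex. *)
Definition ratf a : ratfun K := tofrac a.
Local Notation "a %:F" := (ratf a) : ring_scope.

Lemma ratfD a b : (a + b)%:F = a%:F + b%:F. Proof. exact: tofracD. Qed.
Lemma ratfN a : (- a)%:F = - a%:F. Proof. exact: tofracN. Qed.
Lemma ratfB a b : (a - b)%:F = a%:F - b%:F. Proof. exact: tofracB. Qed.
Lemma ratfM a b : (a * b)%:F = a%:F * b%:F. Proof. exact: tofracM. Qed.
Lemma ratfX a n : (a ^+ n)%:F = a%:F ^+ n. Proof. exact: tofracXn. Qed.
Lemma ratf1 : 1%:F = 1. Proof. exact: tofrac1. Qed.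
Lemma ratf0 : 0%:F = 0. Proof. exact: tofrac0. Qed.
Lemma ratf_inj a b : a%:F = b%:F -> a = b.
Proof. by rewrite /ratf => /eqP; rewrite tofrac_eq => /eqP. Qed.

Lemma ratf_neq0 a : a != 0 -> a%:F != 0.
Proof. by rewrite /ratf tofrac_eq0. Qed.

Definition unit_ideal : ideal K :=
  @Ideal K (fun=> True) I (fun _ _ _ _ => I) (fun _ _ _ => I).

(** The localized ideal [J_f] without its grading; [sect] is recovered from it by
    [sect_of_loc]. *)
Definition loc J f : set (ratfun K) := fun u => exists n a, J a /\ u = a%:F / (f ^+ n)%:F.

Lemma ratf_div a b f g : f != 0 -> g != 0 -> a%:F / f%:F = b%:F / g%:F -> g * a = f * b.
Proof.
move=> f0 g0 E; apply: ratf_inj; rewrite !ratfM.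
have {}E := congr1 (fun u => u * (f%:F * g%:F)) E.
move: E; rewrite /= {1}mulrA divfK ?ratf_neq0 // [f%:F * g%:F in RHS]mulrC mulrA divfK ?ratf_neq0 //.
by rewrite mulrC => ->; rewrite mulrC.
Qed.

Lemma div_ratf a b f g : f != 0 -> g != 0 -> g * a = f * b -> a%:F / f%:F = b%:F / g%:F.
Proof.
move=> f0 g0 E; apply/eqP; rewrite eqr_div ?ratf_neq0 // -!ratfM.
by rewrite mulrC E mulrC.
Qed.

Lemma loc_ratf J f a : J a -> loc J f a%:F.
Proof. by move=> Ja; exists 0%N, a; rewrite expr0 ratf1 divr1. Qed.

Lemma sect_loc J f e j u : sect J f e j u -> loc J f u.
Proof. by move=> [n [a [Ja _ ->]]]; exists n, a. Qed.

Lemma sect_unit J f e j u : sect J f e j u -> sect unit_ideal f e j u.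
Proof. by move=> [n [a [_ ha ->]]]; exists n, a. Qed.

Section Denominator.
Variable (f : R).
Hypothesis f0 : f != 0.

Let fn0 n : f ^+ n != 0. Proof. by rewrite expf_neq0. Qed.

(** A numerator in [J] and a homogeneous numerator of the same fraction may differ,
    but a power of [f] times the homogeneous one is a multiple of the other. *)
Lemma sect_of_loc J (e : nat) j u : ihomog e%:Z f ->
  loc J f u -> sect unit_ideal f e j u -> sect J f e j u.
Proof.
move=> hf [n [a [Ja ->]]] [m [b [_ hb]]] E.
exists (n + m)%N, (f ^+ n * b); split.
- by rewrite -(ratf_div _ _ E) //; apply: idealM.
- have -> : j + (n + m)%N%:Z * e%:Z = n%:Z * e%:Z + (j + m%:Z * e%:Z) by lia.
  by apply: ihomogM => //; apply: ihomogX.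
- by rewrite E; apply: div_ratf => //; rewrite exprD; ring.
Qed.

Lemma locM J u v : loc unit_ideal f u -> loc J f v -> loc J f (u * v).
Proof.
move=> [n [a [_ ->]]] [m [b [Jb ->]]]; exists (n + m)%N, (a * b).
split; first exact: idealM.
by rewrite mulf_div -!ratfM exprD.
Qed.

Lemma locD J u v : loc J f u -> loc J f v -> loc J f (u + v).
Proof.
move=> [n [a [Ja ->]]] [m [b [Jb ->]]]; exists (n + m)%N, (a * f ^+ m + b * f ^+ n).
split; first exact: (idealD (ideal_mulr _ Ja) (ideal_mulr _ Jb)).
by rewrite addf_div ?ratf_neq0 // -!ratfM -ratfD exprD.
Qed.

Lemma loc0 J : loc J f 0.
Proof. by exists 0%N, 0; split; [exact: ideal0 | rewrite ratf0 mul0r]. Qed.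

Lemma loc_unit_ratf a : loc unit_ideal f a%:F.
Proof. exact: loc_ratf. Qed.

Lemma locN J u : loc J f u -> loc J f (- u).
Proof. by move=> h; rewrite -mulN1r -ratf1 -ratfN; apply: locM h; apply: loc_unit_ratf. Qed.

Lemma locB J u v : loc J f u -> loc J f v -> loc J f (u - v).
Proof. by move=> hu /locN; apply: locD. Qed.

Lemma loc_sum J (I : Type) (r : seq I) (P : pred I) (F : I -> ratfun K) :
  (forall i, P i -> loc J f (F i)) -> loc J f (\sum_(i <- r | P i) F i).
Proof. by move=> h; apply: (big_ind (loc J f)) => //; [apply: loc0 | apply: locD]. Qed.

Lemma loc_unitX u n : loc unit_ideal f u -> loc unit_ideal f (u ^+ n).
Proof.
move=> hu; elim: n => [|n IH]; last by rewrite exprS; apply: locM.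
by rewrite expr0 -ratf1; apply: loc_unit_ratf.
Qed.

Lemma loc_weak J u : loc J f u -> loc unit_ideal f u.
Proof. by move=> [n [a [_ ->]]]; exists n, a. Qed.

(** A chart on which [J] becomes the unit ideal. *)
Lemma loc_all J n u : J (f ^+ n) -> loc unit_ideal f u -> loc J f u.
Proof.
move=> Jf [m [a [_ ->]]]; exists (m + n)%N, (a * f ^+ n).
by split; [exact: idealM | apply: div_ratf => //; rewrite exprD; ring].
Qed.

Lemma loc_mul J g u : g != 0 -> loc J f u -> loc J (f * g) u.
Proof.
move=> g0 [n [a [Ja ->]]]; exists n, (g ^+ n * a); split; first exact: idealM.
by apply: div_ratf; rewrite ?exprMn ?mulf_neq0 ?expf_neq0 //; ring.
Qed.

End Denominator.

Lemma ratf_zmod : zmod_morphism ratf. Proof. exact: ratfB. Qed.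
Lemma ratf_monoid : monoid_morphism ratf.
Proof. by split; [exact: ratf1 | exact: ratfM]. Qed.
HB.instance Definition _ := GRing.isZmodMorphism.Build R (ratfun K) ratf ratf_zmod.
HB.instance Definition _ := GRing.isMonoidMorphism.Build R (ratfun K) ratf ratf_monoid.

Definition ev (w : ratfun K) (h : {poly R}) : ratfun K := (map_poly ratf h).[w].

Lemma evD w (g h : {poly R}) : ev w (g + h) = ev w g + ev w h.
Proof. by rewrite /ev rmorphD hornerD. Qed.
Lemma evB w (g h : {poly R}) : ev w (g - h) = ev w g - ev w h.
Proof. by rewrite /ev rmorphB hornerD hornerN. Qed.
Lemma evM w (g h : {poly R}) : ev w (g * h) = ev w g * ev w h.
Proof. by rewrite /ev rmorphM hornerM. Qed.
Lemma evC w a : ev w a%:P = a%:F.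
Proof. by rewrite /ev map_polyC hornerC. Qed.
Lemma evX w : ev w 'X = w.
Proof. by rewrite /ev map_polyX hornerX. Qed.
Lemma evXn w n : ev w 'X^n = w ^+ n.
Proof. by rewrite /ev map_polyXn hornerXn. Qed.
Lemma evZ w a h : ev w (a *: h) = a%:F * ev w h.
Proof. by rewrite -mul_polyC evM evC. Qed.
Lemma ev_sum w (I : Type) (r : seq I) (P : pred I) (F : I -> {poly R}) :
  ev w (\sum_(i <- r | P i) F i) = \sum_(i <- r | P i) ev w (F i).
Proof. by rewrite /ev rmorph_sum horner_sum. Qed.

Section Chart.
Variables (d : nat) (f : R) (w : ratfun K).
Local Notation J := (idealJ K d).
Hypotheses (f0 : f != 0) (hw : loc unit_ideal f w) (hwd : loc J f (w ^+ d)).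
Hypothesis hvar : forall i : 'I_4, loc J f (('X_i)%:F - ev w (phi K 'X_i)).

Lemma loc_ev h : loc unit_ideal f (ev w h).
Proof.
rewrite -[h]coefK poly_def ev_sum; apply: loc_sum => // i _; rewrite evZ evXn.
by apply: locM => //; [apply: loc_unit_ratf | apply: loc_unitX].
Qed.

(** Both [a |-> a] and [a |-> ev w (phi a)] are ring maps into [R_f], so it suffices
    to compare them modulo [J_f] on the variables. *)
Lemma loc_ev_phi a : loc J f (a%:F - ev w (phi K a)).
Proof.
elim/mpoly_ring_ind: a => [c|//|a b ha hb|a b ha hb].
- by rewrite phiC evC subrr; apply: loc0.
- rewrite ratfD.
  rewrite (rmorphD (phi K)).
  rewrite evD.
  rewrite opprD addrACA.
  exact: (locD f0 ha hb).
- rewrite ratfM (rmorphM (phi K)) evM.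
  rewrite -[_ - _](subrKA (ev w (phi K a) * b%:F)) -mulrBl -mulrBr.
  apply: (locD f0); last exact: (locM (loc_ev _) hb).
  by rewrite mulrC; apply: (locM _ ha); apply: loc_unit_ratf.
Qed.

Lemma loc_ev_vanish h : vanish d h -> loc J f (ev w h).
Proof. by move=> [g ->]; rewrite mulrC evM evXn; apply: locM => //; apply: loc_ev. Qed.

Lemma loc_ev_trunc a : loc J f (a%:F - ev w (\poly_(k < d) (phi K a)`_k)).
Proof.
rewrite -[_ - _](subrKA (ev w (phi K a))); apply: locD => //; first exact: loc_ev_phi.
rewrite -evB; apply: loc_ev_vanish; apply: vanishP => k kd.
by rewrite coefB coef_poly kd subrr.
Qed.

End Chart.

End Localization.

(** * The cochains attached to polynomials in w *)

Section Cochains.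
Variables (K : fieldType) (d : nat).
Local Notation R := (coordring K).
Local Notation "a %:F" := (ratf a) : ring_scope.
Local Notation J := (idealJ K d).
Local Notation I1 := (unit_ideal K).
Implicit Types (a b : R) (u v w : ratfun K) (c : nat -> R).

Local Notation x := ('X_0 : R).
Local Notation y := ('X_1 : R).
Local Notation z := ('X_2 : R).
Local Notation t := ('X_3 : R).

Let X0 (i : 'I_4) : ('X_i : R) != 0. Proof. exact: var_neq0. Qed.
Let F0 (i : 'I_4) : ('X_i : R)%:F != 0. Proof. by apply: ratf_neq0. Qed.

Definition wx : ratfun K := y%:F / x%:F.
Definition wt : ratfun K := z%:F / t%:F.

Lemma loc_slope (i k : 'I_4) : loc I1 'X_i (('X_k)%:F / ('X_i)%:F).
Proof. by exists 1%N, 'X_k; rewrite expr1. Qed.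

Lemma loc_slopeX (i k : 'I_4) : (k == 1) || (k == 2%:R) ->
  loc J 'X_i ((('X_k)%:F / ('X_i)%:F) ^+ d).
Proof.
move=> hk; exists d, ('X_k ^+ d); split; first exact: idealJ_yz.
by rewrite expr_div_n !ratfX.
Qed.

Lemma ev_phivar w i : ev w (phi K 'X_i) = [:: x%:F; x%:F * w; t%:F * w; t%:F]`_i.
Proof.
rewrite phiX /phivar; case: i => [[|[|[|[|]]]] hi] //=;
  by rewrite ?evC ?evZ ?evX.
Qed.

Lemma nth_var (i : nat) (hi : (i < 4)%N) : 'X_(Ordinal hi) = [:: x; y; z; t]`_i.
Proof.
case: i hi => [|[|[|[|]]]] hi //=; congr 'X_[_]; congr (U_(_))%MM; exact: val_inj.
Qed.

(** Only [z] is moved, to [t (y / x)]; the difference is [q / x]. *)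
Lemma chart_x i : loc J x (('X_i)%:F - ev wx (phi K 'X_i)).
Proof.
rewrite ev_phivar /wx; case: i => [[|[|[|[|]]]] hi] //=; rewrite nth_var /=.
- by rewrite subrr; apply: loc0.
- by rewrite mulrC divfK // subrr; apply: loc0.
- exists 1%N, (qform K); split; first exact: idealJ_qform.
  rewrite expr1 /qform ratfB !ratfM; move: (F0 0) => h.
  by apply: (mulIf h); rewrite mulrBl mulrA !divfK //; congr (_ - _); rewrite mulrC.
- by rewrite subrr; apply: loc0.
Qed.

(** Only [y] is moved, to [x (z / t)]; the difference is [- q / t]. *)
Lemma chart_t i : loc J t (('X_i)%:F - ev wt (phi K 'X_i)).
Proof.
rewrite ev_phivar /wt; case: i => [[|[|[|[|]]]] hi] //=; rewrite nth_var /=.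
- by rewrite subrr; apply: loc0.
- exists 1%N, (- qform K); split; first by apply/ideal_opp/idealJ_qform.
  rewrite expr1 /qform opprB ratfB !ratfM; move: (F0 3%:R) => h.
  by apply: (mulIf h); rewrite mulrBl mulrA !divfK //.
- by rewrite mulrC divfK // subrr; apply: loc0.
- by rewrite subrr; apply: loc0.
Qed.

Definition seqpoly c : {poly R} := \poly_(k < d) c k.

(** On the charts of [x] and [t], the value of [\sum_k c_k w^k]; the charts of [y]
    and [z], where [J] is the unit ideal, carry 0. *)
Definition cochain c : {ffun 'I_4 -> ratfun K} :=
  [ffun i : 'I_4 => [:: ev wx (seqpoly c); 0; 0; ev wt (seqpoly c)]`_i].

Lemma ev_seqpoly w c : ev w (seqpoly c) = \sum_(k < d) (c k)%:F * w ^+ k.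
Proof. by rewrite /seqpoly poly_def ev_sum; apply: eq_bigr => k _; rewrite evZ evXn. Qed.

Lemma sect_add (J' : ideal K) f e j u v : f != 0 -> ihomog e%:Z f ->
  sect J' f e j u -> sect J' f e j v -> sect J' f e j (u + v).
Proof.
move=> f0 hf hu hv; rewrite -[v]opprK; apply: sectB => //.
by rewrite -sub0r; apply: sectB => //; apply: sect0.
Qed.

Lemma sect_ev (i k : 'I_4) j c : (forall l, ihomog j (c l)) ->
  sect I1 'X_i 1 j (ev (('X_k)%:F / ('X_i)%:F) (seqpoly c)).
Proof.
move=> hc; rewrite ev_seqpoly; apply: (big_ind (sect I1 'X_i 1 j)).
- exact: sect0.
- by move=> u v; apply: sect_add => //; apply: ihomog_var.
move=> l _; exists l, (c l * 'X_k ^+ l); split=> //.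
  by apply: ihomogM => //; rewrite mulr1; apply: ihomog_varX.
by rewrite -/(ratf _) -/(ratf _) ratfM expr_div_n !ratfX mulrA.
Qed.

Lemma cochain_cech0 j c : (forall l, ihomog j (c l)) -> cech0 I1 j (cochain c).
Proof.
move=> hc i; rewrite ffunE.
case: i => [[|[|[|[|]]]] hi] //=; try exact: sect0.
  by rewrite (nth_var hi) /=; apply: sect_ev.
by rewrite (nth_var hi) /=; apply: sect_ev.
Qed.

Lemma idealJ_mulX (i k : 'I_4) : (i == 1) || (i == 2%:R) || ((k == 1) || (k == 2%:R)) ->
  J (('X_i * 'X_k) ^+ d).
Proof.
rewrite exprMn => /orP[] h; last by apply: idealM; apply: idealJ_yz.
by apply: ideal_mulr; apply: idealJ_yz.
Qed.

(** On the overlap, the two expressions [y / x] and [z / t] of [w] differ by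
    [q / (x t)]. *)
Lemma loc_ev_diff c : loc J (x * t) (ev wt (seqpoly c) - ev wx (seqpoly c)).
Proof.
have xt0 : x * t != 0 by rewrite mulf_neq0.
have hx : loc I1 (x * t) wx by apply: loc_mul => //; apply: loc_slope.
have ht : loc I1 (x * t) wt by rewrite mulrC; apply: loc_mul => //; apply: loc_slope.
have hq : loc J (x * t) (wt - wx).
  exists 1%N, (qform K); split; first exact: idealJ_qform.
  rewrite expr1 /wx /wt -mulNr addf_div // -ratfN -!ratfM -ratfD; congr (ratf _ / ratf _).
    by rewrite /qform; ring.
  by rewrite mulrC.
rewrite !ev_seqpoly -sumrB; apply: loc_sum => // k _.
rewrite -mulrBr; apply: locM; first exact: loc_unit_ratf.
rewrite subrXX [X in loc _ _ X]mulrC; apply: (locM _ hq); apply: (loc_sum xt0) => l _.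
by apply: locM; apply: loc_unitX.
Qed.

Lemma ord03 (i : 'I_4) : i != 1 -> i != 2%:R -> i = 0 \/ i = 3%:R.
Proof.
by case: i => [[|[|[|[|]]]] hi] // _ _; [left | right]; apply: val_inj.
Qed.

Lemma cochain0 c : cochain c 0 = ev wx (seqpoly c). Proof. by rewrite ffunE. Qed.
Lemma cochain1 c : cochain c 1 = 0. Proof. by rewrite ffunE. Qed.
Lemma cochain2 c : cochain c 2%:R = 0. Proof. by rewrite ffunE. Qed.
Lemma cochain3 c : cochain c 3%:R = ev wt (seqpoly c). Proof. by rewrite ffunE. Qed.

Lemma cochain_loc j c i k : (forall l, ihomog j (c l)) ->
  loc J ('X_i * 'X_k) (cochain c k - cochain c i).
Proof.
move=> hc; have XX0 (i' k' : 'I_4) : 'X_i' * 'X_k' != 0 :> R by rewrite mulf_neq0.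
have hl (l : 'I_4) : loc I1 'X_l (cochain c l).
  exact: sect_loc (cochain_cech0 hc l).
have [h|] := boolP ((i == 1) || (i == 2%:R) || ((k == 1) || (k == 2%:R))).
  apply: loc_all; [exact: XX0 | exact: (idealJ_mulX h) |].
  by apply: locB => //; [rewrite mulrC|]; apply: loc_mul.
rewrite !negb_or => /andP[/andP[i1 i2] /andP[k1 k2]].
case: (ord03 i1 i2) => ->; case: (ord03 k1 k2) => ->;
  rewrite ?subrr ?cochain0 ?cochain3; try exact: loc0.
  exact: loc_ev_diff.
rewrite -opprB [X in loc _ X]mulrC; apply: locN; exact: loc_ev_diff.
Qed.

Lemma cochain_cocycle j c : (forall l, ihomog j (c l)) ->
  cocycle1 J j (cech_d (cochain c)).
Proof.
move=> hc; have [h1 h2] := cech_d_piece (cochain_cech0 hc).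
split=> // i k; apply: sect_of_loc => //.
- by rewrite mulf_neq0.
- exact: ihomog_var2.
- by rewrite ffunE /=; apply: cochain_loc hc.
Qed.

End Cochains.

(** * Presentations of graded modules *)

Section GradedMaps.
Variable K : fieldType.
Local Notation R := (coordring K).

(** The components of a preimage in other degrees map to 0, because the pieces of
    the target are independent. *)
Lemma ghom_lift (M N : gmod K) (e : ghom M N) j v :
  (exists u, v = e u) -> gpiece j v -> exists2 u, gpiece j u & v = e u.
Proof.
move=> [u ->] hv; have [s [c [us hc uE]]] := gpiece_span u.
have hM := gpiece_fam M; have hN := gpiece_fam N.
exists (if j \in s then c j else 0); first by case: ifP => _ //; apply: gfam0 hM _.
have E : \sum_(k <- [:: j]) (if k == j then e u else 0) = \sum_(k <- s) e (c k).
  by rewrite big_seq1 eqxx uE raddf_sum.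
have := dfree_eq (gfam0 hN) (gfamB hN) (gfam_free hN) (s := [:: j]) (t := s)
  isT us _ _ E (mem_head _ _).
rewrite eqxx => H; rewrite {1}H; last first.
- by move=> k; apply: ghom_piece.
- by move=> k; case: eqP => [->|_] //; apply: gfam0 hN _.
by case: ifP => // _; rewrite raddf0.
Qed.

(** A homogeneous isomorphism: homogeneous elements lift to homogeneous ones by
    [ghom_lift]. *)
Lemma giso_coker (F G M : gmod K) (f : ghom F G) (e : ghom G M) :
  (forall v, exists u, v = e u) -> exact_at f e -> giso M (coker f).
Proof.
move=> es ek; have /choice [s sE] : forall v, exists u, v = e u by [].
pose g v : coker f := coker_pi f (s v).
have gE u : g (e u) = coker_pi f u.
  apply/coker_pi_eq/ek; rewrite raddfB; apply/eqP; rewrite subr_eq0.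
  exact/eqP/esym/sE.
have glin : linear g.
  move=> a u v; rewrite {1}(sE u) {1}(sE v) -linearP gE coker_piD.
  by congr (_ + _); rewrite -coker_piZ.
pose gM := GRing.isLinear.Build _ _ _ _ g glin.
pose G' : {linear M -> coker f} := HB.pack g gM.
exists G'; split.
  exists (fun q => e (repr q)) => [v|q]; last by rewrite [LHS]gE coker_reprK.
  rewrite [RHS]sE; apply/eqP; rewrite -subr_eq0 -raddfB; apply/eqP/ek.
  by apply/coker_pi_eq; rewrite coker_reprK.
move=> j v; split=> [hv|[u hu E]].
  have [u hu vE] := ghom_lift (es v) hv.
  by exists u => //; rewrite vE; apply: gE.
suff -> : v = e u by apply: ghom_piece.
apply/eqP; rewrite (sE v) -subr_eq0 -raddfB; apply/eqP/ek.
exact/coker_pi_eq.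
Qed.

End GradedMaps.

(** * The map from the free module to the Hartshorne-Rao module *)

Section RaoMap.
Variables (K : fieldType) (d : nat).
Local Notation R := (coordring K).
Local Notation J := (idealJ K d).
Local Notation F0 := (freemod K (twist d.-1 0)).

(** The [r]-th basis vector carries the exponent [d - 1 - r] of [w]: the relation
    [z f_r = t f_(r-1)] of the presentation is [z w^k = t w^(k+1)], so exponents
    decrease with [r].  The exponent 0 has coefficient 0. *)
Definition ucoef (u : F0) : nat -> R := fun k => entry u (d.-1 - k)%N.

Lemma ucoef_ihomog j u : gpiece j u -> forall k, ihomog j (ucoef u k).
Proof.
move=> hu k; rewrite -[j]subr0 -oppr0; exact: entry_ihomog hu (fun=> erefl) _.
Qed.

Definition ucocycle (u : F0) : {ffun 'I_4 * 'I_4 -> ratfun K} :=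
  cech_d (cochain d (ucoef u)).

Lemma ev_seqpoly_lin w a (c e : nat -> R) :
  ev w (seqpoly d (fun k => a * c k + e k)) =
  ratf a * ev w (seqpoly d c) + ev w (seqpoly d e).
Proof.
rewrite !ev_seqpoly mulr_sumr -big_split; apply: eq_bigr => k _ /=.
by rewrite ratfD ratfM mulrDl mulrA.
Qed.

Lemma cochain_lin a (c e : nat -> R) :
  cochain d (fun k => a * c k + e k) = a *: cochain d c + cochain d e.
Proof.
apply/ffunP => i; rewrite !ffunE; case: i => [[|[|[|[|]]]] hi] //=;
 rewrite ?ev_seqpoly_lin //; by rewrite addr0 scaler0.
Qed.

Lemma ucocycle_linear : linear ucocycle.
Proof.
move=> a u v; rewrite /ucocycle -linearP -cochain_lin; congr (cech_d (cochain _ _)).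
by apply/funext => k; apply: entry_lin.
Qed.
HB.instance Definition _ := GRing.isLinear.Build R F0 {ffun 'I_4 * 'I_4 -> ratfun K} _
  ucocycle ucocycle_linear.

Lemma ucocycle_piece j u : gpiece j u -> cocycle1 J j (ucocycle u).
Proof. by move=> hu; apply: cochain_cocycle; apply: ucoef_ihomog. Qed.

Lemma ucocycle_mem u : ucocycle u \in gsub_pred (cocycle1_fam J).
Proof.
apply/asboolP; have [s [c [us hc ->]]] := gpiece_span u.
exists s, (fun j => ucocycle (c j)); split=> //; last exact: raddf_sum.
by move=> j; apply: ucocycle_piece.
Qed.

Definition psi (u : F0) : hartshorne_rao J := coker_pi (delta J) (GSub (ucocycle_mem u)).

Lemma psi_linear : linear psi.
Proof.
move=> a u v; rewrite /psi -[a *: coker_pi _ _]/(coker_scale a (coker_pi _ _)).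
rewrite coker_piZ -coker_piD; congr coker_pi; apply: val_inj.
by rewrite /= linearP.
Qed.
HB.instance Definition _ := GRing.isLinear.Build R F0 (hartshorne_rao J) _ psi psi_linear.

Lemma psi_piece j u : gpiece j u -> gpiece j (psi u).
Proof. by move=> hu; exists (GSub (ucocycle_mem u)) => //; apply: ucocycle_piece. Qed.

Definition Psi : ghom F0 (hartshorne_rao J) := GHom psi_piece.

Lemma Psi_eq0 u : Psi u = 0 <-> exists c : C0 J, ucocycle u = cech_d (val c).
Proof.
apply: (iff_trans (coker_pi0 (delta J) (GSub (ucocycle_mem u)))).
by split=> [[c /(congr1 val) E]|[c E]]; exists c; last apply: val_inj.
Qed.

End RaoMap.

(** * The kernel of Psi is the image of beta *)

Section Kernel.
Variables (K : fieldType) (d : nat).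
Local Notation R := (coordring K).
Local Notation "a %:F" := (ratf a) : ring_scope.
Local Notation J := (idealJ K d).
Local Notation I1 := (unit_ideal K).
Local Notation phi := (phi K).
Implicit Types (a b g : R) (c e p q : nat -> R) (h : {poly R}).

Local Notation x := ('X_0 : R).
Local Notation y := ('X_1 : R).
Local Notation z := ('X_2 : R).
Local Notation t := ('X_3 : R).

Definition in_beta (c : nat -> R) : Prop :=
  exists p q, forall r, (r < d.-1)%N -> c r = beta p q r.

Lemma in_beta_eq c e : (forall r, (r < d.-1)%N -> c r = e r) -> in_beta c -> in_beta e.
Proof. by move=> E [p [q h]]; exists p, q => r rd; rewrite -E // h. Qed.

Lemma in_beta_lin a c e : in_beta c -> in_beta e -> in_beta (fun r => a * c r + e r).
Proof.
move=> [p [q hc]] [p' [q' he]]; exists (fun r => a * p r + p' r), (fun r => a * q r + q' r).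
by move=> r rd; rewrite hc // he // beta_lin.
Qed.

Lemma in_beta0 : in_beta (fun=> 0).
Proof. by exists (fun=> 0), (fun=> 0) => r _; rewrite /beta; ring. Qed.

Definition rcoef (h : {poly R}) : nat -> R := fun r => h`_(d.-1 - r).

Lemma rcoef_sum (I : Type) (s : seq I) (P : pred I) (F : I -> {poly R}) :
  (forall i, P i -> in_beta (rcoef (F i))) -> in_beta (rcoef (\sum_(i <- s | P i) F i)).
Proof.
move=> h; apply: (big_ind (fun h => in_beta (rcoef h))) => //.
  by apply: in_beta_eq in_beta0 => r _; rewrite /rcoef coef0.
move=> f g hf hg; apply: in_beta_eq (in_beta_lin 1 hf hg) => r _.
by rewrite /rcoef coefD mul1r.
Qed.

Lemma rcoefZ a h : in_beta (rcoef h) -> in_beta (rcoef (a *: h)).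
Proof.
move=> hh; apply: in_beta_eq (in_beta_lin a hh in_beta0) => r _.
by rewrite /rcoef coefZ addr0.
Qed.

Lemma rcoefD f h : in_beta (rcoef f) -> in_beta (rcoef h) -> in_beta (rcoef (f + h)).
Proof.
move=> hf hh; apply: in_beta_eq (in_beta_lin 1 hf hh) => r _.
by rewrite /rcoef coefD mul1r.
Qed.

Lemma expand_right a l (P Q : {poly R}) : P * Q * 'X^l - a *: (Q * 'X^l) =
  \sum_(k < size Q) Q`_k *: (P * 'X^(k + l) - a *: 'X^(k + l)).
Proof.
have QE : Q = \sum_(k < size Q) Q`_k *: 'X^k by rewrite -poly_def coefK.
rewrite {1 2}QE mulr_sumr !mulr_suml scaler_sumr -sumrB; apply: eq_bigr => k _.
rewrite scalerBr -!mul_polyC exprD; ring.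
Qed.

(** Modulo the image of [beta], multiplying by [y] is multiplying by [x w], and
    by [z] is multiplying by [t w], where [w] shifts the entries; by induction on
    the polynomial, [phi a] then acts as [a]. *)
Lemma in_beta_phi a l : in_beta (rcoef (phi a * 'X^l - a *: 'X^l)).
Proof.
have Z : in_beta (rcoef 0) by apply: in_beta_eq in_beta0 => r _; rewrite /rcoef coef0.
elim/mpoly_ring_ind: a l => [c|i|a b ha hb|a b ha hb] l.
- by rewrite phiC mul_polyC subrr.
(* minus the unit vector at exponent l; it is zero when l is at least d *)
- pose e r : R := if (d.-1 - r)%N == l then -1 else 0.
  rewrite phiX /phivar; case: i => [[|[|[|[|]]]] hi] //=; rewrite nth_var /= ?mul_polyC ?subrr //.
  (* the variable y: a column of M_d^t *)
  + exists (fun=> 0), e => r rd; rewrite /rcoef -scalerAl -exprS coefB !coefZ !coefXn /beta /e.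
    have -> : (d.-1 - r.+1 == l)%N = (d.-1 - r == l.+1)%N by lia.
    by case: eqP => _; case: eqP => _ /=; ring.
  (* the variable z: a column of N_d^t *)
  + exists e, (fun=> 0) => r rd; rewrite /rcoef -scalerAl -exprS coefB !coefZ !coefXn /beta /e.
    have -> : (d.-1 - r.+1 == l)%N = (d.-1 - r == l.+1)%N by lia.
    by case: eqP => _; case: eqP => _ /=; ring.
- rewrite (rmorphD phi) mulrDl scalerDl opprD addrACA; exact: (rcoefD (ha l) (hb l)).
- rewrite (rmorphM phi) -[_ - _](subrKA (a *: (phi b * 'X^l))); apply: rcoefD; last first.
    by rewrite -scalerA -scalerBr; apply: rcoefZ (hb l).
  rewrite expand_right; apply: rcoef_sum => k _; apply: rcoefZ (ha _).
Qed.

(** The image of [\sum_k c_k w^k] when its coefficients are parametrised as well. *)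
Definition phi_sum (c : nat -> R) : {poly R} := \sum_(k < d) phi (c k) * 'X^k.

(** A vector is congruent to the coefficients of its [phi_sum], hence to those of
    [phi g], which represent [g] times the constant polynomial 1; and 1 has
    no coefficient at the exponents [1, ..., d - 1] which index the vector. *)
Lemma in_beta_phi_sum (u : freemod K (twist d.-1 0)) g :
  (forall k, (k < d)%N -> (phi_sum (ucoef u))`_k = (phi g)`_k) -> in_beta (entry u).
Proof.
move=> E; set c := ucoef u.
have H1 : in_beta (rcoef (\sum_(k < d) (phi (c k) * 'X^k - c k *: 'X^k))).
  by apply: rcoef_sum => k _; apply: in_beta_phi.
have H2 := in_beta_phi g 0.
apply: in_beta_eq (in_beta_lin (-1) H1 H2) => r rd; rewrite /rcoef.
have kd : (d.-1 - r < d)%N by lia.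
have k0 : (d.-1 - r == 0)%N = false by lia.
rewrite sumrB coefB -/(phi_sum c) E // -poly_def coef_poly kd.
rewrite expr0 mulr1 coefB coefZ coef1 k0 mulr0 subr0 mulN1r opprB addrNK.
by rewrite /c /ucoef subKn //; lia.
Qed.

(** Substituting [y = x w] and [z = t w] turns the sum into a telescoping one.  The
    top term is a multiple of [w^d] and the bottom term comes from a polynomial. *)
Lemma phi_sum_beta p q c k : (0 < d)%N -> c 0%N = 0 ->
  (forall k, (0 < k)%N -> (k < d)%N -> c k = beta p q (d.-1 - k)) ->
  (k < d)%N -> (phi_sum c)`_k = (phi (- (z * p d.-1 + y * q d.-1)))`_k.
Proof.
move=> d0 c0 hc kd; rewrite /phi_sum; case: d d0 hc kd => // n _ hc kd /=.
pose T i : {poly R} := (t%:P * phi (p (n - i)%N) + x%:P * phi (q (n - i)%N)) * 'X^(i.+1).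
have E : (\sum_(i < n.+1) phi (c i) * ('X^i : {poly R})) = T n - T 0%N.
  rewrite big_ord_recl /= c0 rmorph0 mul0r add0r.
  rewrite -(telescope_sumr T (leq0n n)) big_mkord; apply: eq_bigr => i _.
  have ni : (i < n)%N by [].
  rewrite /= /bump /= add1n hc // /beta /= subnS prednK ?subn_gt0 // /T.
  rewrite -subnS.
  rewrite rmorphB rmorphD rmorphB !(rmorphM phi) !phiX /phivar /= -!mul_polyC !exprS.
  move: (phi (p (n - i.+1)%N)) (phi (p (n - i)%N)) (phi (q (n - i.+1)%N)) (phi (q (n - i)%N)).
  by move=> P P' Q Q'; ring.
rewrite E coefB /T subnn subn0 coefMXn kd sub0r -coefN.
suff -> : phi (- (z * p n + y * q n)) = - ((t%:P * phi (p n) + x%:P * phi (q n)) * 'X^1).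
  by [].
rewrite rmorphN rmorphD !(rmorphM phi) !phiX /phivar /= -!mul_polyC expr1.
by move: (phi (p n)) (phi (q n)) => P Q; ring.
Qed.

(** Converse direction of the passage through [phi]: congruence modulo [w^d] gives
    congruence modulo [J_f]. *)
Lemma loc_phi_sum (f : R) (w : ratfun K) c g : f != 0 -> loc I1 f w -> loc J f (w ^+ d) ->
  (forall i : 'I_4, loc J f (('X_i)%:F - ev w (phi 'X_i))) ->
  (forall k, (k < d)%N -> (phi_sum c)`_k = (phi g)`_k) ->
  loc J f (ev w (seqpoly d c) - g%:F).
Proof.
move=> f0 hw hwd hvar E.
have P := loc_ev_phi f0 hw hvar.
have -> : ev w (seqpoly d c) - g%:F =
    \sum_(k < d) ((c k)%:F - ev w (phi (c k))) * w ^+ k +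
    (ev w (phi_sum c - phi g) - (g%:F - ev w (phi g))).
  rewrite evB opprB subrKA ev_seqpoly addrA; congr (_ - _).
  rewrite /phi_sum ev_sum -big_split; apply: eq_bigr => k _ /=.
  by rewrite evM evXn mulrBl subrK.
apply: (locD f0).
  by apply: (loc_sum f0) => k _; rewrite mulrC; apply: (locM _ (P _)); apply: loc_unitX.
apply: (locB f0) => //; apply: (loc_ev_vanish f0 hw hwd); apply: vanishP => k kd.
by rewrite coefB E // subrr.
Qed.

Lemma sect_ratf (f : R) (e : nat) j g : ihomog j g -> sect I1 f e j g%:F.
Proof.
by move=> hg; exists 0%N, g; split; rewrite ?mul0r ?addr0 // expr0 rmorph1 divr1.
Qed.

(** By [phi_sum_beta] the cochain of [beta (p, q)] agrees modulo [J] on the charts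
    of [x] and [t] with a polynomial, which is the same on all charts and so
    has zero coboundary. *)
Lemma Psi_beta (hd : (0 < d)%N) (u : freemod K (twist d.-1 0)) j p q :
  gpiece j u -> (forall k, ihomog (j - 1) (p k)) -> (forall k, ihomog (j - 1) (q k)) ->
  (forall r, (r < d.-1)%N -> entry u r = beta p q r) -> Psi K d u = 0.
Proof.
move=> hu hp hq uE; apply/Psi_eq0.
(* phi g is the bottom term of the telescoping sum of phi_sum_beta *)
pose g : R := - (z * p d.-1 + y * q d.-1).
have hg : ihomog j g.
  by apply: ihomogN; apply: ihomogD; rewrite -[j](subrK 1); apply: ihomog_varM.
have B k : (k < d)%N -> (phi_sum (ucoef u))`_k = (phi g)`_k.
  apply: phi_sum_beta => //; first by rewrite /ucoef subn0 entry_out.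
  by move=> l l0 ld; rewrite /ucoef uE //; lia.
have X0 (i : 'I_4) : ('X_i : R) != 0 by apply: var_neq0.
pose c := [ffun i => cochain d (ucoef u) i - g%:F].
have hc : cech0 J j c.
  have hs (i : 'I_4) : sect I1 'X_i 1 j (c i).
    rewrite ffunE; apply: sectB; [exact: X0 | exact: ihomog_var | | exact: sect_ratf].
    by apply: cochain_cech0; apply: ucoef_ihomog.
  move=> i; apply: sect_of_loc => //; first exact: ihomog_var.
  have [hi|] := boolP ((i == 1) || (i == 2%:R)).
    by apply: (loc_all (X0 i) (n := d)); [exact: idealJ_yz | exact: sect_loc (hs i)].
  rewrite negb_or => /andP[i1 i2]; rewrite ffunE.
  case: (ord03 i1 i2) => ->; rewrite ?cochain0 ?cochain3.
    by apply: loc_phi_sum => //; [apply: loc_slope | apply: loc_slopeX | apply: chart_x].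
  by apply: loc_phi_sum => //; [apply: loc_slope | apply: loc_slopeX | apply: chart_t].
exists (GSub (gsub_mem (cech0_fam J) hc)); apply/ffunP => i.
rewrite /ucocycle [LHS]ffunE [RHS]ffunE /=.
have cE k : c k = cochain d (ucoef u) k - g%:F by rewrite ffunE.
by rewrite !cE opprB addrA subrK.
Qed.

(** A fraction whose denominator can be a power of either of two variables is a
    polynomial. *)
Lemma loc_inter (i k : 'I_4) u : i != k -> loc I1 'X_i u -> loc I1 'X_k u ->
  exists a, u = a%:F.
Proof.
move=> ik [n [a [_ ->]]] [m [b [_ E]]].
have E' := ratf_div (expf_neq0 n (var_neq0 K i)) (expf_neq0 m (var_neq0 K k)) E.
have ki : k != i by rewrite eq_sym.
have [c [aE _]] := koszulXn ki E'.
exists c; rewrite aE ratfM mulrC mulKf // ratfX expf_neq0 //.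
exact/ratf_neq0/var_neq0.
Qed.

Lemma C0_loc (c : C0 J) i : loc J 'X_i (val c i).
Proof.
case: c => c /= /asboolP [s [e [_ he ->]]]; rewrite sum_ffunE.
by apply: (loc_sum (var_neq0 K i)) => j _; apply: sect_loc (he j i).
Qed.

(** Clearing the powers of [x] gives an equation in [R] whose right-hand side is in
    [J]; its image under [phi] is compared coefficient by coefficient. *)
Lemma phi_sum_of_loc c g : loc J x (ev (wx K) (seqpoly d c) - g%:F) ->
  forall k, (k < d)%N -> (phi_sum c)`_k = (phi g)`_k.
Proof.
move=> [n [b [/phi_idealJ hb E]]] k kd.
have x0 : x != 0 by apply: var_neq0.
(* x^d times the value of the polynomial at w = y / x *)
pose V := \sum_(k < d) c k * (y ^+ k * x ^+ (d - k)).
have VE : ev (wx K) (seqpoly d c) = V%:F / (x ^+ d)%:F.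
  rewrite ev_seqpoly rmorph_sum mulr_suml; apply: eq_bigr => l _ /=.
  rewrite ratfM -mulrA; congr (_ * _); rewrite /wx expr_div_n -!ratfX.
  by apply: div_ratf; rewrite ?expf_neq0 // -{1}(subnK (ltnW (ltn_ord l))) exprD; ring.
have {}E : x ^+ n * (V - x ^+ d * g) = x ^+ d * b.
  apply: ratf_div; rewrite ?expf_neq0 // -E VE ratfB mulrBl ratfM.
  by congr (_ - _); rewrite mulrAC divff ?mul1r // ratf_neq0 // expf_neq0.
have phiV : phi V = (x ^+ d)%:P * phi_sum c.
  rewrite rmorph_sum /phi_sum mulr_sumr; apply: eq_bigr => l _.
  have xE : x ^+ d = x ^+ (d - l) * x ^+ l by rewrite -exprD subnK // ltnW.
  rewrite !(rmorphM phi) !(rmorphXn phi) !phiX xE; move: (phi (c l)) => P.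
  rewrite /phivar /= exprZn -mul_polyC -!polyC_exp polyCM; ring.
have phix m : phi (x ^+ m) = (x ^+ m)%:P by rewrite (rmorphXn phi) phiX -polyC_exp.
have := congr1 phi E; rewrite (rmorphM phi) (rmorphB phi) !(rmorphM phi) phiV !phix.
move: (phi b) (phi g) hb => B G hb; rewrite -mulrBr mulrA -polyCM.
move=> /(congr1 (fun h : {poly R} => h`_k)); rewrite !coefCM (vanish_coef hb kd) mulr0.
move=> /eqP; rewrite -exprD mulf_eq0 expf_eq0 (negbTE x0) andbF coefB subr_eq0.
by move/eqP.
Qed.

(** If the cocycle of [u] is the coboundary of [v], the difference of the two
    cochains is the same fraction on all charts, hence a polynomial [g] by looking
    at the charts of [y] and [z]; the chart of [x] then gives [phi_sum_of_loc]. *)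
Lemma in_beta_Psi u : Psi K d u = 0 -> in_beta (entry u).
Proof.
move=> /Psi_eq0 [v E].
have H i k : cochain d (ucoef u) k - cochain d (ucoef u) i = val v k - val v i.
  by have := congr1 (fun s : {ffun _} => s (i, k)) E; rewrite !ffunE.
have v1 i : cochain d (ucoef u) i = 0 -> - val v i = cochain d (ucoef u) 0 - val v 0.
  move=> ci; have /eqP := H i 0; rewrite ci subr0 => /eqP ->.
  by rewrite addrAC subrr add0r.
have [|||g gE] := @loc_inter 1 2%:R (cochain d (ucoef u) 0 - val v 0) => //.
- rewrite -(v1 1); [|exact: cochain1]; apply: locN; exact: loc_weak (C0_loc v 1).
- rewrite -(v1 2%:R); [|exact: cochain2]; apply: locN; exact: loc_weak (C0_loc v 2%:R).
apply: (@in_beta_phi_sum u g); apply: phi_sum_of_loc.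
by rewrite -cochain0 -gE subKr; apply: C0_loc.
Qed.

End Kernel.

(** The cocycle condition on three charts, with denominators cleared. *)
Lemma cocycle_clear (F : fieldType) (X Y Z a b c : F) : X != 0 -> Y != 0 -> Z != 0 ->
  b / (X * Z) - a / (X * Y) = c / (Y * Z) -> Z * a = Y * b - X * c.
Proof.
move=> X0 Y0 Z0 E; have {}E : (b / (X * Z) - a / (X * Y)) * (X * Y * Z) = c / (Y * Z) * (X * Y * Z).
  by rewrite E.
have E1 : (b / (X * Z) - a / (X * Y)) * (X * Y * Z) = Y * b - Z * a by field; rewrite X0 Y0 Z0.
have E2 : c / (Y * Z) * (X * Y * Z) = X * c by field; rewrite Y0 Z0.
by rewrite -E2 -E E1; ring.
Qed.

Lemma div_sub (F : fieldType) (X T A B : F) : X != 0 -> T != 0 ->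
  B / T - A / X = (X * B - T * A) / (X * T).
Proof. by move=> X0 T0; field; rewrite X0 T0. Qed.

(** * Surjectivity of Psi *)

Section Surjectivity.
Variables (K : fieldType) (d : nat).
Local Notation R := (coordring K).
Local Notation "a %:F" := (ratf a) : ring_scope.
Local Notation J := (idealJ K d).
Local Notation I1 := (unit_ideal K).
Local Notation phi := (phi K).
Implicit Types (a b g : R) (u v : ratfun K).

Local Notation x := ('X_0 : R).
Local Notation y := ('X_1 : R).
Local Notation z := ('X_2 : R).
Local Notation t := ('X_3 : R).

Let X0 (i : 'I_4) : ('X_i : R) != 0. Proof. exact: var_neq0. Qed.
Let XX0 (i k : 'I_4) : ('X_i * 'X_k : R) != 0. Proof. by rewrite mulf_neq0. Qed.

Lemma sect_exponent (J' : ideal K) f e j u : f != 0 -> ihomog e%:Z f ->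
  sect J' f e j u -> exists n0, forall n, (n0 <= n)%N ->
  exists b, [/\ J' b, ihomog (j + n%:Z * e%:Z) b & u = b%:F / (f ^+ n)%:F].
Proof.
move=> f0 hf [n0 [a [Ja ha ->]]]; exists n0 => n nn.
by have [b [Jb hb E]] := sect_ext f0 hf Ja ha nn; exists b.
Qed.

(** In the cocycle condition with denominators cleared, the numerator of [u]
    appears times a power of ['X_l], and the other terms are multiples of powers of
    ['X_i] and ['X_k].  So each monomial of this numerator is divisible by one of
    these two powers, which simplifies with the denominator. *)
Lemma sect_split (i k l : 'I_4) j (u v : ratfun K) : i != k -> i != l -> k != l ->
  sect I1 ('X_i * 'X_k) 2 j u -> sect I1 ('X_i * 'X_l) 2 j v ->
  sect I1 ('X_k * 'X_l) 2 j (v - u) ->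
  exists ci ck, [/\ sect I1 'X_i 1 j ci, sect I1 'X_k 1 j ck & u = ck - ci].
Proof.
move=> ik il kl.
move=> /(sect_exponent (XX0 _ _) (@ihomog_var2 K _ _)) [n1 h1].
move=> /(sect_exponent (XX0 _ _) (@ihomog_var2 K _ _)) [n2 h2].
move=> /(sect_exponent (XX0 _ _) (@ihomog_var2 K _ _)) [n3 h3].
pose n := (n1 + n2 + n3)%N.
have [|a [_ ha uE]] := h1 n; first by rewrite /n; lia.
have [|b [_ _ vE]] := h2 n; first by rewrite /n; lia.
have [|c [_ _]] := h3 n; first by rewrite /n; lia.
have Xn0 (m : 'I_4) : ('X_m ^+ n)%:F != 0 :> ratfun K by rewrite ratf_neq0 // expf_neq0.
have XXn (m m' : 'I_4) : (('X_m * 'X_m') ^+ n)%:F = ('X_m ^+ n)%:F * ('X_m' ^+ n)%:F :> ratfun K.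
  by rewrite exprMn ratfM.
rewrite vE uE !XXn => /(cocycle_clear (Xn0 i) (Xn0 k) (Xn0 l)).
rewrite -!ratfM -ratfB => /ratf_inj E.
pose P (m : 'X_{1..4}) := (n <= m i)%N.
have [m|a1 a1E] := @divXn K i n (mrestrict P a); first by rewrite msupp_mrestrict => /andP[].
have [m|a2 a2E] := @divXn K k n (mrestrict (predC P) a).
  rewrite msupp_mrestrict => /andP[/= mi ma].
  have := msupp_XnM l n ma; rewrite E => /msuppB_le; rewrite mem_cat.
  case/orP => /msupp_XnM_inv [m' _ /(congr1 (fun m : 'X_{1..4} => (m i, m k)))];
    rewrite !mnm_addXn => -[mi' mk'].
    by move: mk'; rewrite eqxx eq_sym (negbTE kl); lia.
  by move: mi mi'; rewrite /P eqxx eq_sym (negbTE il); lia.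
exists (- (a2%:F / ('X_i ^+ n)%:F)), (a1%:F / ('X_k ^+ n)%:F); split.
- rewrite -mulNr -ratfN; exists n, (- a2); split => //; apply: ihomogN.
  apply: (@ihomog_divXn K k n); rewrite -a2E; apply: ihomog_mrestrict.
  by apply: ihomog_eq ha _; lia.
- exists n, a1; split => //.
  apply: (@ihomog_divXn K i n); rewrite -a1E; apply: ihomog_mrestrict.
  by apply: ihomog_eq ha _; lia.
rewrite opprK addf_div // -!ratfM -ratfD.
apply: div_ratf; rewrite ?exprMn ?mulf_neq0 ?expf_neq0 //.
by rewrite {1}(mrestrict_split P a) a1E a2E; ring.
Qed.

Lemma sect_inter (i k l : 'I_4) j (u : ratfun K) : i != k ->
  sect I1 ('X_i * 'X_l) 2 j u -> sect I1 ('X_k * 'X_l) 2 j u -> sect I1 'X_l 1 j u.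
Proof.
move=> ik.
move=> /(sect_exponent (XX0 _ _) (@ihomog_var2 K _ _)) [n1 h1].
move=> /(sect_exponent (XX0 _ _) (@ihomog_var2 K _ _)) [n2 h2].
pose n := (n1 + n2)%N.
have [|a [_ ha uE]] := h1 n; first by rewrite /n; lia.
have [|b [_ _]] := h2 n; first by rewrite /n; lia.
rewrite uE => /(ratf_div (expf_neq0 _ (XX0 _ _)) (expf_neq0 _ (XX0 _ _))) E.
have ki : k != i by rewrite eq_sym.
have {}E : 'X_k ^+ n * a = 'X_i ^+ n * b.
  by apply: (mulfI (expf_neq0 n (X0 l))); rewrite !mulrA -!exprMn ![_ * 'X_k]mulrC ![_ * 'X_i]mulrC.
have [c [aE _]] := koszulXn ki E.
exists n, c; split; first by [].
  apply: (@ihomog_divXn K i n); rewrite -aE; by apply: ihomog_eq ha _; lia.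
by apply: div_ratf; rewrite ?expf_neq0 // aE exprMn; ring.
Qed.

(** [H^1(P^3, O(j)) = 0]: [sect_split] makes the cocycle trivial on the charts of
    [x] and [y], and [sect_inter] shows that the same correction works on the
    others. *)
Lemma cech_split j s : cocycle1 I1 j s -> exists2 c, cech0 I1 j c & s = cech_d c.
Proof.
move=> [hs es].
have [||||||c0 [c1 [h0 h1 E]]] := @sect_split 0 1 2%:R j (s (0, 1)) (s (0, 2%:R)) => //.
  by have := es 0 1 2%:R => <-; rewrite addrC addKr.
exists [ffun k => c0 + s (0, k)] => [k|]; last first.
  apply/ffunP => -[i k]; rewrite !ffunE /= opprD addrACA subrr add0r.
  by rewrite -(es 0 i k) addrAC subrr add0r.
rewrite ffunE; have s00 : s (0, 0) = 0 by apply: (addrI (s (0, 0))); rewrite es addr0.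
have [->|k0] := eqVneq k 0; first by rewrite s00 addr0.
have [->|k1] := eqVneq k 1; first by rewrite E addrC subrK.
(* both expressions have the k-th variable as common denominator *)
have c01 : c0 + s (0, k) = c1 + s (1, k).
  by rewrite -(es 0 1 k) E addrA [c0 + _]addrC subrK.
apply: (@sect_inter 0 1) => //.
  apply: sect_add => //; first exact: ihomog_var2.
  exact: sect_restr.
rewrite c01; apply: sect_add => //; first exact: ihomog_var2.
exact: sect_restr.
Qed.

(** A function on the chart is, modulo [J], the polynomial in [w] that [phi] attaches
    to its numerator, divided by the denominator. *)
Lemma loc_align (f : R) w a n (al : nat -> R) :
  f != 0 -> loc I1 f w -> loc J f (w ^+ d) ->
  (forall i : 'I_4, loc J f (('X_i)%:F - ev w (phi 'X_i))) ->
  (forall k, (k < d)%N -> (phi a)`_k = f ^+ n * al k) ->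
  loc J f (a%:F / (f ^+ n)%:F - ev w (seqpoly d al)).
Proof.
move=> f0 hw hwd hvar E.
have fn0 : (f ^+ n)%:F != 0 by rewrite ratf_neq0 // expf_neq0.
have -> : ev w (seqpoly d al) = (1%:F / (f ^+ n)%:F) * ev w (\poly_(k < d) (phi a)`_k).
  have -> : \poly_(k < d) (phi a)`_k = f ^+ n *: seqpoly d al.
    by apply/polyP => k; rewrite coefZ !coef_poly; case: ltnP => [/E|_] //; rewrite mulr0.
  by rewrite evZ mulrA ratf1 divfK ?mul1r.
rewrite -[a%:F]mul1r -ratf1 mulrAC -mulrBr; apply: locM; first by exists n, 1.
exact: loc_ev_trunc.
Qed.

Lemma cech_d_shift (c c1 c2 : {ffun 'I_4 -> ratfun K}) w :
  (forall i, c2 i = c i - c1 i - w) -> cech_d c = cech_d c1 + cech_d c2.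
Proof.
move=> h; apply/ffunP => i; rewrite !ffunE !h.
by move: (c _) (c _) (c1 _) (c1 _) => A B C D; ring.
Qed.

Hypothesis hd : (0 < d)%N.

(** Surjectivity in each degree.  On the overlap of the charts of [x] and [t] the
    two numerators [a] and [b] satisfy [x^n phi(b)_k = t^m phi(a)_k], so the
    common coefficient [phi(a)_k / x^n = phi(b)_k / t^m] of [w^k] is a
    polynomial. *)
Lemma cocycle_cochain j s : cocycle1 J j s -> exists (u : freemod K (twist d.-1 0)) c,
  cech0 J j c /\ s = ucocycle u + cech_d c.
Proof.
move=> [hs es]; have [c hc sE] : exists2 c, cech0 I1 j c & s = cech_d c.
  by apply: cech_split; split=> // i k; apply: sect_unit (hs i k).
have [n [a [_ ha c0E]]] := hc 0; have [m [b [_ hb c3E]]] := hc 3%:R.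
have [l [e [/phi_idealJ he eE]]] := sect_loc (hs 0 3%:R).
have E : (x * t) ^+ l * (x ^+ n * b - t ^+ m * a) = x ^+ n * t ^+ m * e.
  have xt0 : x ^+ n * t ^+ m != 0 by rewrite mulf_neq0 ?expf_neq0.
  have tx0 : (x * t) ^+ l != 0 by rewrite expf_neq0.
  apply: (ratf_div xt0 tx0); rewrite -eE sE ffunE /= c0E c3E ratfB !ratfM.
  by symmetry; apply: div_sub; rewrite ratf_neq0 // expf_neq0.
have phx k : phi (x ^+ k) = (x ^+ k)%:P by rewrite (rmorphXn phi) phiX polyC_exp.
have pht k : phi (t ^+ k) = (t ^+ k)%:P by rewrite (rmorphXn phi) phiX polyC_exp.
have coefE k : (k < d)%N -> x ^+ n * (phi b)`_k = t ^+ m * (phi a)`_k.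
  move=> kd; have := congr1 phi E; rewrite exprMn !(rmorphM phi) (rmorphB phi) !(rmorphM phi).
  rewrite !phx !pht; move: (phi a) (phi b) (phi e) he => A B C hC.
  move=> /(congr1 (fun h : {poly R} => h`_k)); rewrite -!polyCM !coefCM coefB !coefCM.
  rewrite (vanish_coef hC kd) mulr0 => /eqP; rewrite !mulf_eq0 !expf_eq0.
  by rewrite !(negbTE (X0 _)) !andbF /= subr_eq0 => /eqP.
have /choice [al alE] : forall k, exists g, ihomog j g /\
    ((k < d)%N -> (phi a)`_k = x ^+ n * g /\ (phi b)`_k = t ^+ m * g).
  move=> k; have [kd|_] := boolP (k < d)%N; last by exists 0; split=> //; apply: ihomog0.
  have [//|g [bE aE]] := koszulXn _ (coefE k kd).
  exists g; split=> //; apply: (@ihomog_divXn K 0 n); rewrite -aE.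
  by apply: phi_ihomog; apply: ihomog_eq ha _; lia.
pose u : freemod K (twist d.-1 0) := column d.-1 (fun r => al (d.-1 - r)%N).
have uE k : (0 < k)%N -> (k < d)%N -> ucoef u k = al k.
  by move=> k0 kd; rewrite /ucoef (entry_column d.-1) /cut (_ : (d.-1 - k < d.-1)%N) ?subKn //; lia.
have u0 : ucoef u 0 = 0 by rewrite /ucoef subn0 entry_out.
have hu : gpiece j u.
  by move=> i; rewrite mxE oppr0 subr0; case: (alE (d.-1 - i)%N).
have evE w : ev w (seqpoly d al) = ev w (seqpoly d (ucoef u)) + (al 0%N)%:F.
  rewrite !ev_seqpoly; move: (ucoef u) u0 uE => cu cu0 uE'.
  move: hd uE'; case: (d) => // d' _ uE'; rewrite !big_ord_recl cu0 expr0 !mulr1 ratf0 add0r addrC; congr (_ + _).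
  by apply: eq_bigr => i _; rewrite uE' // ltnS.
exists u, [ffun i => c i - cochain d (ucoef u) i - (al 0%N)%:F]; split; last first.
  by rewrite sE /ucocycle; apply: (cech_d_shift (w := (al 0%N)%:F)) => i; rewrite ffunE.
have hs' (i : 'I_4) : sect I1 'X_i 1 j (c i - cochain d (ucoef u) i - (al 0%N)%:F).
  apply: sectB; [exact: X0 | exact: ihomog_var | | by apply: sect_ratf; case: (alE 0%N)].
  apply: sectB; [exact: X0 | exact: ihomog_var | exact: hc |].
  by apply: cochain_cech0; apply: ucoef_ihomog.
move=> i; rewrite ffunE; apply: sect_of_loc => //; first exact: ihomog_var.
have [hi|] := boolP ((i == 1) || (i == 2%:R)).
  by apply: (loc_all (X0 i) (n := d)); [exact: idealJ_yz | exact: sect_loc (hs' i)].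
rewrite negb_or => /andP[i1 i2].
case: (ord03 i1 i2) => ->; rewrite -addrA -opprD ?cochain0 ?cochain3 -evE ?c0E ?c3E.
  apply: loc_align; rewrite ?X0 //;
    [apply: loc_slope | apply: loc_slopeX | apply: chart_x | by move=> k /(proj2 (alE k))[]] => //.
apply: loc_align; rewrite ?X0 //;
  [apply: loc_slope | apply: loc_slopeX | apply: chart_t | by move=> k /(proj2 (alE k))[]] => //.
Qed.

Lemma Psi_surj (v : hartshorne_rao J) : exists u : freemod K (twist d.-1 0), v = Psi K d u.
Proof.
have [s [c [_ hc ->]]] := gpiece_span v.
elim: s => [|j s [u uE]]; first by exists 0; rewrite big_nil raddf0.
have [w hw vE] := hc j; have [u' [e [he wE]]] := cocycle_cochain hw.
exists (u' + u); rewrite big_cons uE raddfD; congr (_ + _); rewrite vE.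
apply/coker_pi_eq; exists (GSub (gsub_mem (cech0_fam J) he)).
by apply: val_inj; rewrite /= wE addrC addKr.
Qed.

End Surjectivity.

(** * The presentation matrix and the conclusion *)

Section Main.
Variables (K : fieldType) (d : nat).
Local Notation R := (coordring K).
Local Notation J := (idealJ K d).
Hypothesis hd : (1 < d)%N.
Let d0 : (0 < d)%N. Proof. exact: ltnW. Qed.

Lemma bidiag_sum (a b : R) (U : 'I_d -> R) (W : nat -> R) (r : 'I_d.-1) :
  (forall k : 'I_d, U k = W k) ->
  \sum_k (bidiag a b d)^T r k * U k = a * W r + b * W r.+1.
Proof.
move=> UW; have r1 : (r < d)%N by have := ltn_ord r; lia.
have r2 : (r.+1 < d)%N by have := ltn_ord r; lia.
rewrite (bigD1 (Ordinal r1)) //= (bigD1 (Ordinal r2)) //=; last first.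
  by rewrite -val_eqE /=; lia.
rewrite big1 => [|k /andP[k1 k2]].
  by rewrite addr0 !UW !mxE /= eqxx (_ : (r.+1 == r)%N = false) ?eqxx //; lia.
rewrite !mxE; move: k1 k2; rewrite -!val_eqE /= => /negbTE -> /negbTE ->.
by rewrite mul0r.
Qed.

Lemma presentation_mapE (u : freemod K (twist (d + d) (-1))) (r : 'I_d.-1) :
  (presentation_map K d u : 'cV_ _) r 0 = beta (lo d u) (hi d u) r.
Proof.
rewrite mxE big_split_ord /=.
have hl (k : 'I_d) : u (lshift d k) 0 = lo d u k.
  by rewrite /lo /cut ltn_ord -entry_ord.
have hr (k : 'I_d) : u (rshift d k) 0 = hi d u k by rewrite /hi -entry_ord.
under eq_bigr do rewrite row_mxEl; under [X in _ + X]eq_bigr do rewrite row_mxEr.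
rewrite (bidiag_sum _ _ _ hl) (bidiag_sum _ _ _ hr) /beta; ring.
Qed.

Lemma Psi_exact_diff0 : exact_at (diff0 K hd) (Psi K d).
Proof.
move=> v; split=> [/in_beta_Psi [p [q pq]]|[u ->]].
  exists (column (2 * d) (glue d p q)); rewrite col_ghomE /diff0_fun.
  have e2d : (2 * d = d + d)%N by rewrite mul2n addnn.
  rewrite (lo_column _ _ e2d) (hi_column _ _ e2d).
  apply/colP => i; rewrite mxE -entry_ord pq //= /beta /cut.
  have i1 : (i < d)%N by have := ltn_ord i; rewrite /=; lia.
  have i2 : (i.+1 < d)%N by have := ltn_ord i; rewrite /=; lia.
  by rewrite i1 i2.
have [s [c [us hc ->]]] := gpiece_span u; rewrite !raddf_sum big1 // => j _.
have h := entry_ihomog (hc j) (fun=> erefl).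
apply: (@Psi_beta K d d0 _ j (lo d (c j)) (hi d (c j))).
- exact: ghom_piece.
- by move=> k; apply: (@cut_ihomog K d _ _ h).
- by move=> k; apply: h.
- move=> r rd; transitivity (entry (column d.-1 (diff0_fun (c j))) r) => //.
  by rewrite entry_column /cut rd.
Qed.

(** The columns of the presentation matrix are indexed by [d + d] and those of the
    differential by [2 * d]; both have the image of [beta]. *)
Lemma Psi_exact_presentation : exact_at (presentation_map K d) (Psi K d).
Proof.
have e2d : (2 * d = d + d)%N by rewrite mul2n addnn.
have H (v : freemod K (twist d.-1 0)) m (u : 'cV[R]_m) : m = (d + d)%N ->
    (forall r, v r 0 = beta (lo d u) (hi d u) r) ->
    forall m', m' = (d + d)%N -> exists u' : 'cV[R]_m',
      forall r, v r 0 = beta (lo d u') (hi d u') r.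
  move=> mE h m' m'E; have mm : m = m' by rewrite mE m'E.
  by case: m' / mm {m'E}; exists u.
move=> v; rewrite Psi_exact_diff0; split=> -[u vE].
  have [|u' h] := H v _ u e2d _ (d + d)%N erefl.
    by move=> r; rewrite vE mxE.
  by exists u'; apply/colP => r; rewrite h presentation_mapE.
have [|u' h] := H v _ u erefl _ (2 * d)%N e2d.
  by move=> r; rewrite vE presentation_mapE.
by exists u'; apply/colP => r; rewrite h mxE.
Qed.

End Main.

Theorem corollary3p2 (K : closedFieldType) (d : nat) (hd : (2 <= d)%N) :
  let M_C := hartshorne_rao (idealJ K d) in
  giso M_C (coker (presentation_map K d)) /\
  has_min_free_res M_C (fun i : nat =>
    match i with
    | 0%N => twist d.-1 0
    | 1%N => twist (2 * d) (-1)
    | 2%N => gens_add (twist d.+1 (- d%:Z)) (twist d.+1 (- 2%:Z))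
    | 3%N => twist (2 * d) (- d%:Z - 1)
    | 4%N => twist d.-1 (- d%:Z - 2%:Z)
    | _ => twist 0 0
    end).
Proof.
have Ps := @Psi_surj K d (ltnW hd); split.
  exact: giso_coker Ps (Psi_exact_presentation hd).
exact: (@resolution K d hd _ (Psi K d) Ps (Psi_exact_diff0 hd)).
Qed.
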